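(* Let $(H,\xi_H)$ be a finite-dimensional monoidal Hom-Hopf algebra with bijective antipode $S$ over a field $k$, and let $(A,\xi_A)$ be an $(H,\xi_H)$-Hom-bicomodule algebra (so that $(H,A,H)$ is a Yetter-Drinfeld Hom-datum). Then the category ${}_{A}\mathcal{MHYD}^{H}(H)$ of Yetter-Drinfeld Hom-modules and the category ${}_{H^{*}\bowtie A}\mathcal{M}$ of left Hom-modules over the diagonal crossed Hom-product $H^{*}\bowtie A$ are isomorphic.
   Context: Everything is over a field $k$. The monoidal Hom-category $\widetilde{\mathcal H}(\mathcal M_k)$ has as objects pairs $(M,\xi_M)$ with $M$ a $k$-vector space and $\xi_M$ a linear automorphism of $M$; morphisms are linear maps $f:M\to N$ with $\xi_N f=f\xi_M$; the tensor product is $(M\otimes N,\xi_M\otimes\xi_N)$, the unit is $(k,\mathrm{id})$, and the associativity constraint is $(m\otimes n)\otimes l\mapsto \xi_M(m)\otimes(n\otimes\xi_L^{-1}(l))$. A monoidal Hom-algebra $(A,\xi_A)$ is an object with $1_A\in A$ and a bilinear product such that $\xi_A(ab)=\xi_A(a)\xi_A(b)$, $\xi_A(1_A)=1_A$, $\xi_A(a)(bc)=(ab)\xi_A(c)$, $a1_A=1_Aa=\xi_A(a)$. Algebra morphisms preserve products and units and commute with the structure automorphisms; tensor products of algebras carry the componentwise product. A monoidal Hom-coalgebra $(C,\xi_C)$ has $\Delta(c)=c_1\otimes c_2$ and $\varepsilon$ with $\Delta\xi_C=(\xi_C\otimes\xi_C)\Delta$, $\varepsilon\xi_C=\varepsilon$,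 $\xi_C^{-1}(c_1)\otimes\Delta(c_2)=\Delta(c_1)\otimes\xi_C^{-1}(c_2)$, $c_1\varepsilon(c_2)=\xi_C^{-1}(c)=\varepsilon(c_1)c_2$. A monoidal Hom-Hopf algebra $(H,\xi_H)$ is both, with $\Delta,\varepsilon$ multiplicative and unital, and with an antipode $S$, a linear map commuting with $\xi_H$ with $S(h_1)h_2=\varepsilon(h)1_H=h_1S(h_2)$. A left $(A,\xi_A)$-Hom-module is an object $(M,\xi_M)$ with an action satisfying $\xi_A(a)\cdot(b\cdot m)=(ab)\cdot\xi_M(m)$, $\xi_M(a\cdot m)=\xi_A(a)\cdot\xi_M(m)$, $1_A\cdot m=\xi_M(m)$. A right $(C,\xi_C)$-Hom-comodule is an object $(M,\xi_M)$ with $\rho_M(m)=m_0\otimes m_1\in M\otimes C$ satisfying $\xi_M^{-1}(m_0)\otimes\Delta(m_1)=m_{00}\otimes m_{01}\otimes\xi_C^{-1}(m_1)$, $\rho_M\xi_M=(\xi_M\otimes\xi_C)\rho_M$, $m_0\varepsilon(m_1)=\xi_M^{-1}(m)$. Left Hom-comodules are defined symmetrically. Morphisms of (co)modules are linear maps commuting with the $\xi$'s and the (co)actions. An $(H,\xi_H)$-Hom-bicomodule algebra is a monoidal Hom-algebra $(A,\xi_A)$ with a left $H$-Hom-comodule structure $\rho_l(a)=a_{[-1]}\otimes a_{[0]}\in H\otimes A$ and a right $H$-Hom-comodule structure $\rho_r(a)=a_{<0>}\otimes a_{<1>}\in A\otimes H$, both of which are Hom-algebra morphisms, such that $a_{<0>[-1]}\otimes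 a_{<0>[0]}\otimes\xi_H^{-1}(a_{<1>})=\xi_H^{-1}(a_{[-1]})\otimes a_{[0]<0>}\otimes a_{[0]<1>}$. The Yetter-Drinfeld Hom-datum $(H,A,H)$ consists of $H$, such an $A$, and the second $H$ regarded as an $H$-Hom-bimodule coalgebra via multiplication. ${}_{A}\mathcal{MHYD}^{H}(H)$: objects are $(M,\xi_M)$ that are left $A$-Hom-modules and right $H$-Hom-comodules with $$(a\cdot m)_0\otimes(a\cdot m)_1=\xi_A(a_{[0]<0>})\cdot m_0\otimes\big(a_{[0]<1>}\,\xi_H^{-1}(m_1)\big)S^{-1}(a_{[-1]})$$ for all $a\in A$, $m\in M$ (equivalently $a_{<0>}\cdot m_0\otimes a_{<1>}m_1=\xi_M((a_{[0]}\cdot\xi_M^{-1}(m))_0)\otimes(a_{[0]}\cdot\xi_M^{-1}(m))_1a_{[-1]}$). Morphisms are $A$-linear, $H$-colinear maps. For finite-dimensional $H$, write $\xi_H^{*}(f)=f\circ\xi_H$. The dual $(H^*,\xi_H^{*-1})$ has product $\langle fg,h\rangle=\langle f,h_1\rangle\langle g,h_2\rangle$ with unit $\varepsilon$, and coproduct $f_1\otimes f_2$ given by $\langle f_1,h\rangle\langle f_2,l\rangle=\langle f,hl\rangle$. Put $h\rightharpoonup f=\langle f_2,\xi_H^{-1}(h)\rangle\xi_H^{*-2}(f_1)$ and $f\leftharpoonup h=\langle f_1,\xi_H^{-1}(h)\rangle\xi_H^{*-2}(f_2)$. The diagonal crossed Hom-product $H^*\bowtie A$ is $H^*\otimes A$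 with structure automorphism $\xi_H^{*-1}\otimes\xi_A$, unit $\varepsilon\bowtie1_A$, and product $$(f\bowtie a)(g\bowtie b)=f\big(a_{[-1]}\rightharpoonup(\xi_H^{*2}(g)\leftharpoonup S^{-1}(a_{[0]<1>}))\big)\bowtie\xi_A^2(a_{[0]<0>})\,b .$$ *)

(* Defs.v *)
From HB Require Import structures.
From mathcomp Require Import all_boot all_order all_algebra.
From mathcomp Require Import generic_quotient sesquilinear.
From mathcomp Require Import boolp.

Set Implicit Arguments.
Unset Strict Implicit.
Unset Printing Implicit Defensive.

Import GRing.Theory.
Local Open Scope ring_scope.
Local Open Scope quotient_scope.


(* M (x) N is the set of formal sums of pairs, two sums being identified when
   every bilinear map gives them the same value. *)
Section Tensor.
Variables (k : fieldType) (M N : lmodType k).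

Definition tens_eval (P : lmodType k) (b : M -> N -> P) (s : seq (M * N)) : P :=
  \sum_(p <- s) b p.1 p.2.

Definition tens_rel (s t : seq (M * N)) : bool :=
  `[< forall (P : lmodType k) (b : {bilinear M -> N -> P}),
        tens_eval b s = tens_eval b t >].

Lemma tens_relxx : reflexive tens_rel.
Proof. by move=> s; apply/asboolP. Qed.

Lemma tens_rel_sym : symmetric tens_rel.
Proof. by move=> s t; apply/asboolP/asboolP => h P b; rewrite h. Qed.

Lemma tens_rel_trans : transitive tens_rel.
Proof.
by move=> s t u /asboolP h1 /asboolP h2; apply/asboolP => P b; rewrite h1 h2.
Qed.

Canonical tens_equiv := EquivRel tens_rel tens_relxx tens_rel_sym tens_rel_trans.

Definition tensor := {eq_quot tens_rel}.
HB.instance Definition _ := EqQuotient.on tensor.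
HB.instance Definition _ := Choice.on tensor.

Lemma tens_piP (s t : seq (M * N)) :
  (forall (P : lmodType k) (b : {bilinear M -> N -> P}),
     tens_eval b s = tens_eval b t) ->
  \pi_tensor s = \pi_tensor t.
Proof. by move=> h; apply/eqmodP/asboolP. Qed.

Lemma tens_eval_repr (P : lmodType k) (b : {bilinear M -> N -> P}) s :
  tens_eval b (repr (\pi_tensor s)) = tens_eval b s.
Proof.
have /asboolP h : tens_rel (repr (\pi_tensor s)) s by apply/eqmodP; rewrite reprK.
exact: h.
Qed.

Lemma tens_piW (Q : tensor -> Prop) :
  (forall s, Q (\pi_tensor s)) -> forall t, Q t.
Proof. by move=> h t; rewrite -[t]reprK. Qed.

Definition tens_zero : tensor := \pi_tensor [::].
Definition tens_add (t u : tensor) : tensor := \pi_tensor (repr t ++ repr u).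
Definition tens_scale (c : k) (t : tensor) : tensor :=
  \pi_tensor [seq (c *: p.1, p.2) | p <- repr t].
Definition tens_opp (t : tensor) : tensor := tens_scale (-1) t.

Lemma tens_eval_cat (P : lmodType k) (b : M -> N -> P) s t :
  tens_eval b (s ++ t) = tens_eval b s + tens_eval b t.
Proof. by rewrite /tens_eval big_cat. Qed.

Lemma tens_eval_scale (P : lmodType k) (b : {bilinear M -> N -> P}) c s :
  tens_eval b [seq (c *: p.1, p.2) | p <- s] = c *: tens_eval b s.
Proof.
rewrite /tens_eval big_map scaler_sumr; apply: eq_bigr => p _ /=.
by rewrite linearZl_LR.
Qed.

Lemma tens_addE s t :
  tens_add (\pi_tensor s) (\pi_tensor t) = \pi_tensor (s ++ t).
Proof. by apply: tens_piP => P b; rewrite !tens_eval_cat !tens_eval_repr. Qed.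

Lemma tens_scaleE c s :
  tens_scale c (\pi_tensor s) = \pi_tensor [seq (c *: p.1, p.2) | p <- s].
Proof. by apply: tens_piP => P b; rewrite !tens_eval_scale tens_eval_repr. Qed.

Lemma tens_addA : associative tens_add.
Proof.
move=> x y z; elim/tens_piW: x => s; elim/tens_piW: y => t.
elim/tens_piW: z => u; by rewrite !tens_addE catA.
Qed.

Lemma tens_addC : commutative tens_add.
Proof.
move=> x y; elim/tens_piW: x => s; elim/tens_piW: y => t; rewrite !tens_addE.
by apply: tens_piP => P b; rewrite !tens_eval_cat addrC.
Qed.

Lemma tens_add0 : left_id tens_zero tens_add.
Proof. by elim/tens_piW => s; rewrite /tens_zero tens_addE. Qed.

Lemma tens_addN : left_inverse tens_zero tens_opp tens_add.
Proof.
elim/tens_piW => s; rewrite /tens_opp tens_scaleE tens_addE /tens_zero.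
apply: tens_piP => P b; rewrite tens_eval_cat tens_eval_scale scaleN1r addNr.
by rewrite /tens_eval big_nil.
Qed.

HB.instance Definition _ := GRing.isZmodule.Build tensor
  tens_addA tens_addC tens_add0 tens_addN.

Lemma tens_scaleA a b t : tens_scale a (tens_scale b t) = tens_scale (a * b) t.
Proof.
elim/tens_piW: t => s; rewrite !tens_scaleE; apply: tens_piP => P f.
by rewrite !tens_eval_scale scalerA.
Qed.

Lemma tens_scale1 : left_id 1 tens_scale.
Proof.
elim/tens_piW => s; rewrite !tens_scaleE; apply: tens_piP => P f.
by rewrite !tens_eval_scale scale1r.
Qed.

Lemma tens_scaleDr : right_distributive tens_scale +%R.
Proof.
move=> a x y; elim/tens_piW: x => s; elim/tens_piW: y => t.
rewrite -[LHS]/(tens_scale a (tens_add _ _)).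
rewrite -[RHS]/(tens_add (tens_scale _ _) (tens_scale _ _)).
rewrite tens_addE !tens_scaleE tens_addE; apply: tens_piP => P f.
by rewrite tens_eval_cat !tens_eval_scale tens_eval_cat scalerDr.
Qed.

Lemma tens_scaleDl t : {morph tens_scale^~ t : a b / a + b}.
Proof.
elim/tens_piW: t => s a b.
rewrite -[RHS]/(tens_add (tens_scale _ _) (tens_scale _ _)).
rewrite !tens_scaleE tens_addE; apply: tens_piP => P f.
by rewrite tens_eval_cat !tens_eval_scale scalerDl.
Qed.

HB.instance Definition _ := GRing.Zmodule_isLmodule.Build k tensor
  tens_scaleA tens_scale1 tens_scaleDr tens_scaleDl.

Definition tens (x : M) (y : N) : tensor := \pi_tensor [:: (x, y)].

(* Sweedler sum: the value sum_i b x_i y_i at t = sum_i x_i (x) y_i.  It does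
   not depend on the chosen decomposition of t as soon as b is bilinear
   (tsum_tens, tsum_linear, tsum_unique below). *)
Definition tsum (P : lmodType k) (t : tensor) (b : M -> N -> P) : P :=
  tens_eval b (repr t).

End Tensor.

Notation "x ⊗ y" := (tens x y) (at level 40, left associativity) : ring_scope.
Notation "'\tsum_(' x '⊗' y '<-' t ')' e" := (tsum t (fun x y => e))
  (at level 41, x name, y name, t at level 200, e at level 41,
   format "'[' \tsum_( x  ⊗  y  <-  t ) '/  '  e ']'") : ring_scope.

Section TensorTheory.
Variables (k : fieldType) (M N P : lmodType k).

Definition is_bilinear (b : M -> N -> P) : Prop :=
  (forall y, linear (b^~ y)) /\ (forall x, linear (b x)).

Section Pack.
Variables (b : M -> N -> P) (hb : is_bilinear b).
Definition bilinear_fun_of : M -> N -> P := b.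
Lemma bilinear_fun_of_subproof : bilinear_for *:%R *:%R bilinear_fun_of.
Proof. by case: hb. Qed.
HB.instance Definition _ := @bilinear_isBilinear.Build k M N P *:%R *:%R
  bilinear_fun_of bilinear_fun_of_subproof.
Definition bilinear_of : {bilinear M -> N -> P} := bilinear_fun_of.
End Pack.

Lemma is_bilinearP (b : {bilinear M -> N -> P}) : is_bilinear b.
Proof. by split=> [y c u v|x c u v]; rewrite ?linearPl ?linearPr. Qed.

Lemma tsum_tens (b : M -> N -> P) x y :
  is_bilinear b -> tsum (x ⊗ y) b = b x y.
Proof.
move=> hb; rewrite /tsum /tens (tens_eval_repr (bilinear_of hb)).
by rewrite /tens_eval big_seq1.
Qed.

Lemma tsum_linear (b : M -> N -> P) :
  is_bilinear b -> linear (fun t : tensor M N => tsum t b).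
Proof.
move=> hb c x y; elim/tens_piW: x => s; elim/tens_piW: y => t.
rewrite -[c *: _ + _]/(tens_add (tens_scale _ _) _) tens_scaleE tens_addE.
pose B := bilinear_of hb; rewrite /tsum !(tens_eval_repr B).
by rewrite tens_eval_cat (tens_eval_scale B).
Qed.

End TensorTheory.

Section TensorTheory2.
Variables (k : fieldType) (M N : lmodType k).

Lemma tens_bilinear : is_bilinear (@tens k M N).
Proof.
split=> [y|x] c u v.
  rewrite -[RHS]/(tens_add (tens_scale _ _) _) tens_scaleE tens_addE.
  apply: tens_piP => P b; rewrite /tens_eval big_cat /= !big_seq1 /=.
  by rewrite linearPl linearZl_LR.
rewrite -[RHS]/(tens_add (tens_scale _ _) _) tens_scaleE tens_addE.
apply: tens_piP => P b; rewrite /tens_eval big_cat /= !big_seq1 /=.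
by rewrite linearPr linearZl_LR.
Qed.

Lemma tensDl (x x' : M) (y : N) : (x + x') ⊗ y = x ⊗ y + x' ⊗ y.
Proof. by have := tens_bilinear.1 y 1 x x'; rewrite !scale1r. Qed.
Lemma tensDr (x : M) (y y' : N) : x ⊗ (y + y') = x ⊗ y + x ⊗ y'.
Proof. by have := tens_bilinear.2 x 1 y y'; rewrite !scale1r. Qed.
Lemma tens0l (y : N) : (0 : M) ⊗ y = 0.
Proof. by apply: (@addrI _ (0 ⊗ y)); rewrite -tensDl !addr0. Qed.
Lemma tens0r (x : M) : x ⊗ (0 : N) = 0.
Proof. by apply: (@addrI _ (x ⊗ 0)); rewrite -tensDr !addr0. Qed.
Lemma tensZl c (x : M) (y : N) : (c *: x) ⊗ y = c *: (x ⊗ y).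
Proof. by have := tens_bilinear.1 y c x 0; rewrite tens0l !addr0. Qed.
Lemma tensZr c (x : M) (y : N) : x ⊗ (c *: y) = c *: (x ⊗ y).
Proof. by have := tens_bilinear.2 x c y 0; rewrite tens0r !addr0. Qed.

Lemma tens_repr (t : tensor M N) : t = \sum_(p <- repr t) p.1 ⊗ p.2.
Proof.
rewrite -[t in LHS]reprK; elim: (repr t) => [|p s IH]; first by rewrite big_nil.
by rewrite big_cons -IH -[RHS]/(tens_add _ _) /tens tens_addE; case: p.
Qed.

Lemma tens_ind (Q : tensor M N -> Prop) :
  Q 0 -> (forall x y t, Q t -> Q (x ⊗ y + t)) -> forall t, Q t.
Proof.
move=> Q0 QD t; rewrite [t]tens_repr.
by elim: (repr t) => [|p s IH]; rewrite ?big_nil ?big_cons //; apply: QD.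
Qed.

Lemma tsum_id (t : tensor M N) : \tsum_(x ⊗ y <- t) (x ⊗ y) = t.
Proof. by rewrite [RHS]tens_repr. Qed.

Variable P : lmodType k.

Lemma tsum_unique (b : M -> N -> P) (f : {linear tensor M N -> P}) :
  (forall x y, f (x ⊗ y) = b x y) -> forall t, f t = tsum t b.
Proof.
move=> fb t; rewrite [t in LHS]tens_repr linear_sum.
by apply: eq_bigr => p _; rewrite fb.
Qed.

Lemma tensor_ext (f g : {linear tensor M N -> P}) :
  (forall x y, f (x ⊗ y) = g (x ⊗ y)) -> f =1 g.
Proof. by move=> fg t; rewrite (tsum_unique fg) -(tsum_unique (f := g)). Qed.

Lemma eq_tsum (t : tensor M N) (b b' : M -> N -> P) :
  (forall x y, b x y = b' x y) -> tsum t b = tsum t b'.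
Proof. by move=> bb'; apply: eq_bigr => p _. Qed.

Lemma linear_tsum (Q : lmodType k) (f : {linear P -> Q}) t (b : M -> N -> P) :
  f (tsum t b) = \tsum_(x ⊗ y <- t) f (b x y).
Proof. by rewrite /tsum /tens_eval linear_sum. Qed.

Lemma tsum_fun_linear (U : lmodType k) (t : tensor M N) (b : U -> M -> N -> P) :
  (forall x y, linear (fun u => b u x y)) -> linear (fun u => tsum t (b u)).
Proof.
move=> hb c u v; rewrite /tsum /tens_eval scaler_sumr -big_split /=.
by apply: eq_bigr => p _; rewrite hb.
Qed.

End TensorTheory2.

Section LinearMaps.
Variable k : fieldType.

Section Of.
Variables (U V : lmodType k) (f : U -> V) (hf : linear f).
Definition linear_fun_of : U -> V := f.
Lemma linear_fun_of_subproof : linear linear_fun_of. Proof. exact: hf. Qed.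
HB.instance Definition _ := GRing.isLinear.Build k U V *:%R linear_fun_of
  linear_fun_of_subproof.
Definition linear_of : {linear U -> V} := linear_fun_of.
End Of.

Lemma linear_ext (U V : lmodType k) (f g : {linear U -> V}) : f =1 g -> f = g.
Proof.
case: f => f cf; case: g => g cg /= fg.
have {}fg : f = g by apply: funext.
by subst g; congr GRing.Linear.Pack; case: cf cg => [[?] [?]] [[?] [?]];
  congr GRing.Linear.Class; congr (_ _); exact: Prop_irrelevance.
Qed.

Section Inverse.
Variables (U V : lmodType k) (f : {linear U -> V}) (bf : bijective f).

Lemma linv_ex (y : V) : exists x, f x == y.
Proof. by case: bf => g _ gK; exists (g y); rewrite gK. Qed.

Definition linv_fun (y : V) : U := xchoose (linv_ex y).

Lemma linv_funK : cancel linv_fun f.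
Proof. by move=> y; apply/eqP/(xchooseP (linv_ex y)). Qed.

Lemma linv_fun_linear : linear linv_fun.
Proof.
by move=> c x y; apply: (bij_inj bf); rewrite linearP !linv_funK.
Qed.

Definition linv : {linear V -> U} := linear_of linv_fun_linear.

Lemma linvKV : cancel linv f. Proof. exact: linv_funK. Qed.
Lemma linvK : cancel f linv.
Proof. by move=> x; apply: (bij_inj bf); rewrite linvKV. Qed.

End Inverse.

Record hom_aut (V : lmodType k) := HomAut {
  aut_fun :> {linear V -> V};
  aut_bij : bijective aut_fun }.

Definition aut_inv (V : lmodType k) (xi : hom_aut V) : hom_aut V :=
  HomAut (Bijective (linvKV (aut_bij xi)) (linvK (aut_bij xi))).

Arguments linv : simpl never.
Arguments aut_inv : simpl never.

Lemma aut_invK (V : lmodType k) (xi : hom_aut V) : cancel xi (aut_inv xi).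
Proof. exact: linvK. Qed.
Lemma aut_invKV (V : lmodType k) (xi : hom_aut V) : cancel (aut_inv xi) xi.
Proof. exact: linvKV. Qed.

Lemma tens_map_bilinear (U U' V V' : lmodType k)
    (f : {linear U -> U'}) (g : {linear V -> V'}) :
  is_bilinear (fun x y => f x ⊗ g y).
Proof.
by split=> [y|x] c u v; rewrite linearP (tens_bilinear _ _).1
  || rewrite linearP (tens_bilinear _ _).2.
Qed.

Definition tens_map (U U' V V' : lmodType k)
    (f : {linear U -> U'}) (g : {linear V -> V'}) :
    {linear tensor U V -> tensor U' V'} :=
  linear_of (tsum_linear (tens_map_bilinear f g)).

Arguments tens_map : simpl never.

Lemma tens_mapE (U U' V V' : lmodType k)
    (f : {linear U -> U'}) (g : {linear V -> V'}) x y :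
  tens_map f g (x ⊗ y) = f x ⊗ g y.
Proof. exact/tsum_tens/tens_map_bilinear. Qed.

Lemma tens_aut_bij (U V : lmodType k) (f : hom_aut U) (g : hom_aut V) :
  bijective (tens_map f g).
Proof.
have id_ext (h : {linear tensor U V -> tensor U V}) :
    (forall x y, h (x ⊗ y) = x ⊗ y) -> forall t, h t = t.
  by move=> hE; apply: (tensor_ext (g := idfun)).
pose F := tens_map f g; pose G := tens_map (aut_inv f) (aut_inv g).
exists G.
  by apply: (id_ext (G \o F)) => x y; rewrite -[LHS]/(G (F _)) !tens_mapE !aut_invK.
by apply: (id_ext (F \o G)) => x y; rewrite -[LHS]/(F (G _)) !tens_mapE !aut_invKV.
Qed.

Definition tens_aut (U V : lmodType k) (f : hom_aut U) (g : hom_aut V) :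
  hom_aut (tensor U V) := HomAut (tens_aut_bij f g).

End LinearMaps.

Section LinearMapsTheory.
Variable k : fieldType.

Lemma bilinear_ext (U V W : lmodType k) (f g : {bilinear U -> V -> W}) :
  (forall x y, f x y = g x y) -> f = g.
Proof.
case: f => f cf; case: g => g cg /= fg.
have {}fg : f = g by apply: funext => x; apply: funext => y.
subst g; congr Bilinear.Pack; case: cf cg => [[? ? ? ?]] [[? ? ? ?]].
by congr Bilinear.Class; congr isBilinear.Axioms_; exact: Prop_irrelevance.
Qed.

Lemma linear_funP (U V : lmodType k) (f : {linear U -> V}) : linear f.
Proof. by move=> c u v; rewrite linearP. Qed.

Lemma tsum_comp_linear (U M N P : lmodType k) (f : {linear U -> tensor M N})
    (b : M -> N -> P) :
  is_bilinear b -> linear (fun u => tsum (f u) b).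
Proof. by move=> hb c u v; rewrite linearP (tsum_linear hb). Qed.

Lemma linfunE (U V : vectType k) (f : U -> V) : linear f -> linfun f =1 f.
Proof. by move=> hf x; rewrite -[f]/(linear_of hf : U -> V) lfunE. Qed.

Lemma linfun_linear (W : lmodType k) (U V : vectType k) (F : W -> U -> V) :
  (forall w, linear (F w)) -> (forall x, linear (fun w => F w x)) ->
  linear (fun w => linfun (F w)).
Proof.
move=> h1 h2 c u v; apply/lfunP => x.
by rewrite add_lfunE scale_lfunE !linfunE // h2.
Qed.

End LinearMapsTheory.

(* An object (M, xi) of the monoidal Hom-category is a vector space
   M : lmodType k together with xi : hom_aut M. *)

Section HomStructures.
Variable k : fieldType.

Record hom_mul (A : lmodType k) := HomMul {
  hmul : {bilinear A -> A -> A};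
  hone : A }.

Record is_hom_algebra (A : lmodType k) (xi : hom_aut A) (m : hom_mul A) : Prop :=
  IsHomAlgebra {
  ha_xiM : forall a b, xi (hmul m a b) = hmul m (xi a) (xi b);
  ha_xi1 : xi (hone m) = hone m;
  ha_assoc : forall a b c,
    hmul m (xi a) (hmul m b c) = hmul m (hmul m a b) (xi c);
  ha_mul1 : forall a, hmul m a (hone m) = xi a;
  ha_1mul : forall a, hmul m (hone m) a = xi a }.

Record hom_algebra (A : lmodType k) (xi : hom_aut A) := HomAlgebra {
  ha_mul :> hom_mul A;
  ha_ax : is_hom_algebra xi ha_mul }.

Record hom_coalgebra (C : lmodType k) (xi : hom_aut C) := HomCoalgebra {
  hDelta : {linear C -> tensor C C};
  heps : {linear C -> k^o};
  hc_Delta_xi : forall c,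
    hDelta (xi c) = \tsum_(c1 ⊗ c2 <- hDelta c) (xi c1 ⊗ xi c2);
  hc_eps_xi : forall c, heps (xi c) = heps c;
  hc_coassoc : forall c,
    \tsum_(c1 ⊗ c2 <- hDelta c) (aut_inv xi c1 ⊗ hDelta c2) =
    \tsum_(c1 ⊗ c2 <- hDelta c) \tsum_(c11 ⊗ c12 <- hDelta c1)
      (c11 ⊗ (c12 ⊗ aut_inv xi c2));
  hc_counitr : forall c,
    \tsum_(c1 ⊗ c2 <- hDelta c) (heps c2 *: c1) = aut_inv xi c;
  hc_counitl : forall c,
    \tsum_(c1 ⊗ c2 <- hDelta c) (heps c1 *: c2) = aut_inv xi c }.

Record hom_hopf (H : lmodType k) (xi : hom_aut H) := HomHopf {
  hh_alg :> hom_algebra xi;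
  hh_coalg :> hom_coalgebra xi;
  antipode : {linear H -> H};
  hh_DeltaM : forall g h,
    hDelta hh_coalg (hmul hh_alg g h) =
    \tsum_(g1 ⊗ g2 <- hDelta hh_coalg g) \tsum_(h1 ⊗ h2 <- hDelta hh_coalg h)
      (hmul hh_alg g1 h1 ⊗ hmul hh_alg g2 h2);
  hh_Delta1 : hDelta hh_coalg (hone hh_alg) = hone hh_alg ⊗ hone hh_alg;
  hh_epsM : forall g h,
    heps hh_coalg (hmul hh_alg g h) = heps hh_coalg g * heps hh_coalg h;
  hh_eps1 : heps hh_coalg (hone hh_alg) = 1;
  hh_S_xi : forall h, antipode (xi h) = xi (antipode h);
  hh_Sl : forall h,
    \tsum_(h1 ⊗ h2 <- hDelta hh_coalg h) hmul hh_alg (antipode h1) h2 =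
    heps hh_coalg h *: hone hh_alg;
  hh_Sr : forall h,
    \tsum_(h1 ⊗ h2 <- hDelta hh_coalg h) hmul hh_alg h1 (antipode h2) =
    heps hh_coalg h *: hone hh_alg }.

Record is_left_module (A : lmodType k) (xiA : hom_aut A) (m : hom_mul A)
    (M : lmodType k) (xiM : hom_aut M) (act : {bilinear A -> M -> M}) : Prop :=
  IsLeftModule {
  lm_assoc : forall a b x,
    act (xiA a) (act b x) = act (hmul m a b) (xiM x);
  lm_xi : forall a x, xiM (act a x) = act (xiA a) (xiM x);
  lm_one : forall x, act (hone m) x = xiM x }.

Record is_right_comodule (C : lmodType k) (xiC : hom_aut C)
    (hC : hom_coalgebra xiC) (M : lmodType k) (xiM : hom_aut M)
    (rho : {linear M -> tensor M C}) : Prop := IsRightComodule {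
  rc_coassoc : forall x,
    \tsum_(x0 ⊗ x1 <- rho x) (aut_inv xiM x0 ⊗ hDelta hC x1) =
    \tsum_(x0 ⊗ x1 <- rho x) \tsum_(x00 ⊗ x01 <- rho x0)
      (x00 ⊗ (x01 ⊗ aut_inv xiC x1));
  rc_xi : forall x, rho (xiM x) = \tsum_(x0 ⊗ x1 <- rho x) (xiM x0 ⊗ xiC x1);
  rc_counit : forall x,
    \tsum_(x0 ⊗ x1 <- rho x) (heps hC x1 *: x0) = aut_inv xiM x }.

(* The coaction is x |-> x1 (x) x0 with x1 in C and x0 in M. *)
Record is_left_comodule (C : lmodType k) (xiC : hom_aut C)
    (hC : hom_coalgebra xiC) (M : lmodType k) (xiM : hom_aut M)
    (rho : {linear M -> tensor C M}) : Prop := IsLeftComodule {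
  lc_coassoc : forall x,
    \tsum_(x1 ⊗ x0 <- rho x) \tsum_(x11 ⊗ x12 <- hDelta hC x1)
      (x11 ⊗ (x12 ⊗ aut_inv xiM x0)) =
    \tsum_(x1 ⊗ x0 <- rho x) (aut_inv xiC x1 ⊗ rho x0);
  lc_xi : forall x, rho (xiM x) = \tsum_(x1 ⊗ x0 <- rho x) (xiC x1 ⊗ xiM x0);
  lc_counit : forall x,
    \tsum_(x1 ⊗ x0 <- rho x) (heps hC x1 *: x0) = aut_inv xiM x }.

Record hom_bicomod_algebra (H : lmodType k) (xiH : hom_aut H)
    (hH : hom_hopf xiH) (A : lmodType k) (xiA : hom_aut A) := HomBicomodAlgebra {
  ba_alg :> hom_algebra xiA;
  rho_l : {linear A -> tensor H A};
  rho_r : {linear A -> tensor A H};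
  ba_left : is_left_comodule hH xiA rho_l;
  ba_right : is_right_comodule hH xiA rho_r;
  ba_rho_lM : forall a b,
    rho_l (hmul ba_alg a b) =
    \tsum_(a1 ⊗ a0 <- rho_l a) \tsum_(b1 ⊗ b0 <- rho_l b)
      (hmul hH a1 b1 ⊗ hmul ba_alg a0 b0);
  ba_rho_l1 : rho_l (hone ba_alg) = hone hH ⊗ hone ba_alg;
  ba_rho_rM : forall a b,
    rho_r (hmul ba_alg a b) =
    \tsum_(a0 ⊗ a1 <- rho_r a) \tsum_(b0 ⊗ b1 <- rho_r b)
      (hmul ba_alg a0 b0 ⊗ hmul hH a1 b1);
  ba_rho_r1 : rho_r (hone ba_alg) = hone ba_alg ⊗ hone hH;
  ba_compat : forall a,
    \tsum_(a0 ⊗ a1 <- rho_r a) \tsum_(a01 ⊗ a00 <- rho_l a0)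
      (a01 ⊗ (a00 ⊗ aut_inv xiH a1)) =
    \tsum_(a1 ⊗ a0 <- rho_l a) (aut_inv xiH a1 ⊗ rho_r a0) }.

End HomStructures.

Section Dual.
Variables (k : fieldType) (H : vectType k) (xi : hom_aut H) (hH : hom_hopf xi).
Local Notation Hd := 'Hom(H, k^o).

Lemma xi_star_linear : linear (fun f : Hd => linfun (f \o xi) : Hd).
Proof.
apply: linfun_linear => [f|x] c u v /=; first by rewrite !linearP.
by rewrite add_lfunE scale_lfunE.
Qed.

Lemma lfun_compE (f : Hd) (g : {linear H -> H}) x :
  (linfun (f \o g) : Hd) x = f (g x).
Proof. by apply: linfunE => c u v /=; rewrite !linearP. Qed.

Lemma xi_star_bij : bijective (linear_of xi_star_linear).
Proof.
exists (fun f : Hd => linfun (f \o aut_inv xi)) => f; apply/lfunP => x.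
  by rewrite lfun_compE lfun_compE aut_invKV.
by rewrite [LHS]lfun_compE lfun_compE aut_invK.
Qed.

(* xi_star f = f o xi; the structure automorphism of Hd is its inverse. *)
Definition xi_star : hom_aut Hd := HomAut xi_star_bij.
Definition xi_dual : hom_aut Hd := aut_inv xi_star.

Lemma xi_starE (f : Hd) h : xi_star f h = f (xi h).
Proof. exact: lfun_compE. Qed.

Lemma xi_dualE (f : Hd) h : xi_dual f h = f (aut_inv xi h).
Proof. by rewrite -[f in RHS](aut_invKV xi_star) xi_starE aut_invKV. Qed.

Definition dual_mul_fun (f g : Hd) : Hd :=
  linfun (fun h => \tsum_(h1 ⊗ h2 <- hDelta hH h) (f h1 * g h2) : k^o).

Lemma dual_pairing_bilinear (f g : Hd) :
  is_bilinear (fun h1 h2 : H => f h1 * g h2 : k^o).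
Proof.
split=> [y|x] c u v; rewrite linearP; first by rewrite mulrDl -scalerAl.
by rewrite mulrDr -scalerAr.
Qed.

Lemma dual_mulE f g h :
  dual_mul_fun f g h = \tsum_(h1 ⊗ h2 <- hDelta hH h) (f h1 * g h2 : k^o).
Proof. exact/linfunE/tsum_comp_linear/dual_pairing_bilinear. Qed.

Lemma dual_mul_bilinear : is_bilinear dual_mul_fun.
Proof.
split=> [g|f]; apply: linfun_linear => [w|h];
  do ?[exact/tsum_comp_linear/dual_pairing_bilinear];
  apply: tsum_fun_linear => x y c u v; rewrite add_lfunE scale_lfunE.
- by rewrite mulrDl -scalerAl.
- by rewrite mulrDr -scalerAr.
Qed.

Definition dual_mul : {bilinear Hd -> Hd -> Hd} :=
  bilinear_of dual_mul_bilinear.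

Definition dual_one : Hd := linfun (heps hH).

(* Coproduct of the dual: the element f1 (x) f2 of Hd (x) Hd with f1(h) f2(l) = f(hl), written in a
   basis of H; see dual_coprodP and dual_coprod_uniq. *)
Definition dual_coprod (f : Hd) : tensor Hd Hd :=
  \sum_(i < \dim (fullv : {vspace H}))
    linfun (fun h => f (hmul hH h (vbasis fullv)`_i))
      ⊗ linfun (coord (vbasis fullv) i : H -> k^o).

Lemma eval2_bilinear (h l : H) :
  is_bilinear (fun f1 f2 : Hd => f1 h * f2 l : k^o).
Proof.
split=> [y|x] c u v; rewrite add_lfunE scale_lfunE.
  by rewrite mulrDl -scalerAl.
by rewrite mulrDr -scalerAr.
Qed.

Lemma dual_sliceE (f : Hd) (e h : H) :
  (linfun (fun h => f (hmul hH h e)) : Hd) h = f (hmul hH h e).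
Proof. by apply: linfunE => c u v; rewrite linearPl linearP. Qed.

Lemma dual_coordE (i : 'I_(\dim (fullv : {vspace H}))) (l : H) :
  (linfun (coord (vbasis fullv) i : H -> k^o) : Hd) l =
  coord (vbasis fullv) i l.
Proof. by apply: linfunE => c u v; rewrite linearP. Qed.

Lemma dual_coprodP (f : Hd) (h l : H) :
  \tsum_(f1 ⊗ f2 <- dual_coprod f) (f1 h * f2 l : k^o) = f (hmul hH h l).
Proof.
have hb := eval2_bilinear h l.
rewrite -[LHS]/(linear_of (tsum_linear hb) _) linear_sum /=.
rewrite [l in RHS](coord_vbasis (memvf l)) linear_sumr linear_sum.
apply: eq_bigr => i _; rewrite -[LHS]/(tsum _ _) tsum_tens //.
by rewrite dual_sliceE dual_coordE linearZr_LR linearZ /= mulrC.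
Qed.

Lemma dual_expand (g : Hd) :
  g = \sum_(i < \dim (fullv : {vspace H}))
        g (vbasis fullv)`_i *: linfun (coord (vbasis fullv) i : H -> k^o).
Proof.
apply/lfunP => l; rewrite sum_lfunE {1}[l](coord_vbasis (memvf l)) linear_sum.
by apply: eq_bigr => i _; rewrite scale_lfunE dual_coordE linearZ; apply: mulrC.
Qed.

Lemma dual_coprod_uniq (f : Hd) (t : tensor Hd Hd) :
  (forall h l, \tsum_(f1 ⊗ f2 <- t) (f1 h * f2 l : k^o) = f (hmul hH h l)) ->
  t = dual_coprod f.
Proof.
pose e i := (vbasis (fullv : {vspace H}))`_i.
pose n := \dim (fullv : {vspace H}).
pose E (i : 'I_n) : Hd := linfun (coord (vbasis fullv) i : H -> k^o).
have tens_expand (x y : Hd) :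
    x ⊗ y = \sum_(i < n) \sum_(j < n) (x (e i) * y (e j) : k) *: (E i ⊗ E j).
  rewrite {1}[x]dual_expand {1}[y]dual_expand.
  rewrite -[LHS]/(bilinear_of (@tens_bilinear k Hd Hd) _ _) linear_sumlz.
  apply: eq_bigr => i _; rewrite linear_sumr; apply: eq_bigr => j _.
  by rewrite linearZl_LR linearZr_LR scalerA.
pose L i j := linear_of (tsum_linear (eval2_bilinear (e i) (e j))).
have tE (u : tensor Hd Hd) :
    u = \sum_(i < n) \sum_(j < n) (L i j u : k) *: (E i ⊗ E j).
  elim/tens_ind: u => [|x y u IH].
    rewrite big1 // => i _; rewrite big1 // => j _.
    by rewrite linear0 scale0r.
  rewrite {1}IH {1}tens_expand -big_split; apply: eq_bigr => i _.
  rewrite -big_split; apply: eq_bigr => j _.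
  rewrite linearD scalerDl; congr (_ *: _ + _).
  exact/esym/(tsum_tens x y (eval2_bilinear (e i) (e j))).
move=> ht; rewrite [t]tE [dual_coprod f]tE.
apply: eq_bigr => i _; apply: eq_bigr => j _; congr (_ *: _).
by rewrite -[LHS]/(tsum _ _) ht -[RHS]/(tsum _ _) dual_coprodP.
Qed.

Lemma dual_coprod_linear : linear dual_coprod.
Proof.
move=> c f g; apply/esym/dual_coprod_uniq => h l.
rewrite (tsum_linear (eval2_bilinear h l)) !dual_coprodP.
by rewrite add_lfunE scale_lfunE.
Qed.

(* hitl h f is the left harpoon h -> f, hitr f h the right harpoon f <- h. *)
Definition hitl (h : H) (f : Hd) : Hd :=
  \tsum_(f1 ⊗ f2 <- dual_coprod f)
    ((f2 (aut_inv xi h) : k) *: aut_inv xi_star (aut_inv xi_star f1)).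

Definition hitr (f : Hd) (h : H) : Hd :=
  \tsum_(f1 ⊗ f2 <- dual_coprod f)
    ((f1 (aut_inv xi h) : k) *: aut_inv xi_star (aut_inv xi_star f2)).

Lemma hitl_bilinear : is_bilinear hitl.
Proof.
split=> [f|h].
  apply: tsum_fun_linear => f1 f2 c u v; rewrite !linearP scalerDl.
  by rewrite scalerA.
apply: (@tsum_comp_linear _ _ _ _ _ (linear_of dual_coprod_linear)).
split=> [y|x] c u v; first by rewrite !linearP !scalerA mulrC.
by rewrite add_lfunE scale_lfunE scalerDl scalerA.
Qed.

Lemma hitr_bilinear : is_bilinear hitr.
Proof.
split=> [h|f].
  apply: (@tsum_comp_linear _ _ _ _ _ (linear_of dual_coprod_linear)).
  split=> [y|x] c u v; first by rewrite add_lfunE scale_lfunE scalerDl scalerA.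
  by rewrite !linearP !scalerA mulrC.
apply: tsum_fun_linear => f1 f2 c u v; rewrite !linearP scalerDl.
by rewrite scalerA.
Qed.

End Dual.

Section DiagonalCrossedProduct.
Variables (k : fieldType) (H : vectType k) (xiH : hom_aut H).
Variables (hH : hom_hopf xiH) (bS : bijective (antipode hH)).
Variables (A : lmodType k) (xiA : hom_aut A) (hA : hom_bicomod_algebra hH xiA).
Local Notation Hd := 'Hom(H, k^o).

(* diag_prod f a g b is (f # a)(g # b), with # for the bow tie. *)
Definition diag_prod (f : Hd) (a : A) (g : Hd) (b : A) : tensor Hd A :=
  \tsum_(a1 ⊗ a0 <- rho_l hA a) \tsum_(a00 ⊗ a01 <- rho_r hA a0)
    (dual_mul hH f
       (hitl hH a1 (hitr hH (xi_star xiH (xi_star xiH g)) (linv bS a01)))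
     ⊗ hmul hA (xiA (xiA a00)) b).

Lemma diag_prod_linear1 a g b : linear (fun f => diag_prod f a g b).
Proof.
do 2!apply: tsum_fun_linear => ? ?.
by move=> c u v; rewrite linearPl (tens_bilinear _ _).1.
Qed.

Lemma diag_prod_linear2 f g b : linear (fun a => diag_prod f a g b).
Proof.
apply: tsum_comp_linear; split=> [a0|a1].
  apply: tsum_fun_linear => a00 a01 c u v.
  by rewrite (hitl_bilinear _).1 linearPr (tens_bilinear _ _).1.
apply: tsum_comp_linear; split=> [a01|a00] c u v.
  by rewrite !linearP linearPl (tens_bilinear _ _).2.
rewrite linearP (hitr_bilinear _).2 (hitl_bilinear _).2 linearPr.
by rewrite (tens_bilinear _ _).1.
Qed.

Lemma diag_prod_linear3 f a b : linear (fun g => diag_prod f a g b).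
Proof.
do 2!apply: tsum_fun_linear => ? ?.
move=> c u v; rewrite !linearP (hitr_bilinear _).1 (hitl_bilinear _).2.
by rewrite linearPr (tens_bilinear _ _).1.
Qed.

Lemma diag_prod_linear4 f a g : linear (fun b => diag_prod f a g b).
Proof.
do 2!apply: tsum_fun_linear => ? ?.
by move=> c u v; rewrite linearPr (tens_bilinear _ _).2.
Qed.

Definition diag_mul_fun (t u : tensor Hd A) : tensor Hd A :=
  \tsum_(f ⊗ a <- t) \tsum_(g ⊗ b <- u) diag_prod f a g b.

Lemma diag_mul_bilinear : is_bilinear diag_mul_fun.
Proof.
split=> [u|t].
  apply: tsum_linear; split=> [a|f]; apply: tsum_fun_linear => g b.
    exact: diag_prod_linear1.
  exact: diag_prod_linear2.
apply: tsum_fun_linear => f a; apply: tsum_linear; split=> [b|g].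
  exact: diag_prod_linear3.
exact: diag_prod_linear4.
Qed.

Definition diag_crossed : hom_mul (tensor Hd A) :=
  HomMul (bilinear_of diag_mul_bilinear) (dual_one hH ⊗ hone hA).

Definition diag_xi : hom_aut (tensor Hd A) := tens_aut (xi_dual xiH) xiA.

Lemma diag_crossedE f a g b :
  hmul diag_crossed (f ⊗ a) (g ⊗ b) = diag_prod f a g b.
Proof.
rewrite -[LHS]/(diag_mul_fun _ _) /diag_mul_fun tsum_tens.
  rewrite tsum_tens //; split=> [y|x];
    [exact: diag_prod_linear3 | exact: diag_prod_linear4].
split=> [y|x]; apply: tsum_fun_linear => ? ?;
  [exact: diag_prod_linear1 | exact: diag_prod_linear2].
Qed.

End DiagonalCrossedProduct.

Record category := Category {
  ob :> Type;
  mor : ob -> ob -> Type;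
  mor_id : forall X, mor X X;
  mor_comp : forall X Y Z, mor Y Z -> mor X Y -> mor X Z;
  mor_compf1 : forall X Y (f : mor X Y), mor_comp f (mor_id X) = f;
  mor_comp1f : forall X Y (f : mor X Y), mor_comp (mor_id Y) f = f;
  mor_compA : forall X Y Z W (h : mor Z W) (g : mor Y Z) (f : mor X Y),
    mor_comp h (mor_comp g f) = mor_comp (mor_comp h g) f }.
Arguments mor {c} _ _.
Arguments mor_id {c} _.
Arguments mor_comp {c X Y Z} _ _.

Record functor (C D : category) := Functor {
  fob :> C -> D;
  fmor : forall X Y : C, mor X Y -> mor (fob X) (fob Y);
  fmor1 : forall X : C, fmor (mor_id X) = mor_id (fob X);
  fmorD : forall (X Y Z : C) (g : mor Y Z) (f : mor X Y),
    fmor (mor_comp g f) = mor_comp (fmor g) (fmor f) }.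
Arguments fmor {C D} _ {X Y} _.

Definition functor_id (C : category) : functor C C :=
  @Functor C C id (fun X Y f => f) (fun X => erefl) (fun X Y Z g f => erefl).

Section FunctorComp.
Variables (C D E : category) (G : functor D E) (F : functor C D).

Lemma functor_comp1 X :
  fmor G (fmor F (mor_id X)) = mor_id (G (F X)).
Proof. by rewrite !fmor1. Qed.

Lemma functor_compD (X Y Z : C) (g : mor Y Z) (f : mor X Y) :
  fmor G (fmor F (mor_comp g f)) =
  mor_comp (fmor G (fmor F g)) (fmor G (fmor F f)).
Proof. by rewrite !fmorD. Qed.

Definition functor_comp : functor C E :=
  @Functor C E (fun X => G (F X)) (fun X Y f => fmor G (fmor F f))
    functor_comp1 functor_compD.

End FunctorComp.

Definition isomorphic_categories (C D : category) : Prop :=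
  exists (F : functor C D) (G : functor D C),
    functor_comp G F = functor_id C /\ functor_comp F G = functor_id D.

Section ModuleCategory.
Variables (k : fieldType) (A : lmodType k) (xiA : hom_aut A) (m : hom_mul A).

(* m is not required to satisfy is_hom_algebra: the axioms of a Hom-module only
   involve xi, the product and the unit. *)
Record left_module := LeftModule {
  lm_car :> lmodType k;
  lm_xiM : hom_aut lm_car;
  lm_act : {bilinear A -> lm_car -> lm_car};
  lm_ax : is_left_module xiA m lm_xiM lm_act }.

Record left_module_mor (M N : left_module) := LeftModuleMor {
  lmm_fun :> {linear M -> N};
  lmm_xi : forall x, lmm_fun (lm_xiM M x) = lm_xiM N (lmm_fun x);
  lmm_act : forall a x, lmm_fun (lm_act M a x) = lm_act N a (lmm_fun x) }.

Lemma left_module_mor_ext M N (f g : left_module_mor M N) :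
  (forall x, f x = g x) -> f = g.
Proof.
case: f => f f1 f2; case: g => g g1 g2 /= /linear_ext fg; subst g.
by congr LeftModuleMor; exact: Prop_irrelevance.
Qed.

Definition left_module_id M : left_module_mor M M :=
  @LeftModuleMor M M idfun (fun=> erefl) (fun _ _ => erefl).

Section Comp.
Variables (M N P : left_module).
Variables (g : left_module_mor N P) (f : left_module_mor M N).

Lemma left_module_comp_xi x : (g \o f) (lm_xiM M x) = lm_xiM P ((g \o f) x).
Proof. by rewrite /= !lmm_xi. Qed.

Lemma left_module_comp_act a x :
  (g \o f) (lm_act M a x) = lm_act P a ((g \o f) x).
Proof. by rewrite /= !lmm_act. Qed.

Definition left_module_comp : left_module_mor M P :=
  @LeftModuleMor M P (g \o f) left_module_comp_xi left_module_comp_act.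
End Comp.

Definition left_module_category : category.
Proof.
refine (@Category left_module left_module_mor left_module_id left_module_comp
  _ _ _) => *; exact: left_module_mor_ext.
Defined.

End ModuleCategory.

Section YetterDrinfeld.
Variables (k : fieldType) (H : lmodType k) (xiH : hom_aut H).
Variables (hH : hom_hopf xiH) (bS : bijective (antipode hH)).
Variables (A : lmodType k) (xiA : hom_aut A) (hA : hom_bicomod_algebra hH xiA).

Record yd_module := YDModule {
  yd_car :> lmodType k;
  yd_xiM : hom_aut yd_car;
  yd_act : {bilinear A -> yd_car -> yd_car};
  yd_rho : {linear yd_car -> tensor yd_car H};
  yd_left : is_left_module xiA hA yd_xiM yd_act;
  yd_right : is_right_comodule hH yd_xiM yd_rho;
  yd_compat : forall a x,
    yd_rho (yd_act a x) =
    \tsum_(a1 ⊗ a0 <- rho_l hA a) \tsum_(a00 ⊗ a01 <- rho_r hA a0)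
    \tsum_(x0 ⊗ x1 <- yd_rho x)
      (yd_act (xiA a00) x0
       ⊗ hmul hH (hmul hH a01 (aut_inv xiH x1)) (linv bS a1)) }.

Record yd_mor (M N : yd_module) := YDMor {
  ydm_fun :> {linear M -> N};
  ydm_xi : forall x, ydm_fun (yd_xiM M x) = yd_xiM N (ydm_fun x);
  ydm_act : forall a x, ydm_fun (yd_act M a x) = yd_act N a (ydm_fun x);
  ydm_rho : forall x,
    yd_rho N (ydm_fun x) = \tsum_(x0 ⊗ x1 <- yd_rho M x) (ydm_fun x0 ⊗ x1) }.

Lemma yd_mor_ext M N (f g : yd_mor M N) : (forall x, f x = g x) -> f = g.
Proof.
case: f => f f1 f2 f3; case: g => g g1 g2 g3 /= /linear_ext fg; subst g.
by congr YDMor; exact: Prop_irrelevance.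
Qed.

Lemma yd_id_rho (M : yd_module) x :
  yd_rho M (idfun x) = \tsum_(x0 ⊗ x1 <- yd_rho M x) (idfun x0 ⊗ x1).
Proof. by rewrite tsum_id. Qed.

Definition yd_id M : yd_mor M M :=
  @YDMor M M idfun (fun=> erefl) (fun _ _ => erefl) (@yd_id_rho M).

Section Comp.
Variables (M N P : yd_module) (g : yd_mor N P) (f : yd_mor M N).

Lemma yd_comp_xi x : (g \o f) (yd_xiM M x) = yd_xiM P ((g \o f) x).
Proof. by rewrite /= !ydm_xi. Qed.

Lemma yd_comp_act a x : (g \o f) (yd_act M a x) = yd_act P a ((g \o f) x).
Proof. by rewrite /= !ydm_act. Qed.

Lemma yd_comp_rho x :
  yd_rho P ((g \o f) x) = \tsum_(x0 ⊗ x1 <- yd_rho M x) ((g \o f) x0 ⊗ x1).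
Proof.
have hb := @tens_map_bilinear k _ _ _ _ g (idfun : {linear H -> H}).
rewrite /= !ydm_rho -[LHS]/(linear_of (tsum_linear hb) _) linear_tsum.
by apply: eq_tsum => x0 x1; apply: (tsum_tens _ _ hb).
Qed.

Definition yd_comp : yd_mor M P :=
  @YDMor M P (g \o f) yd_comp_xi yd_comp_act yd_comp_rho.
End Comp.

Definition yd_category : category.
Proof.
refine (@Category yd_module yd_mor yd_id yd_comp _ _ _) => *;
  exact: yd_mor_ext.
Defined.

End YetterDrinfeld.

(* Main.v *)
Require Import Defs.
From mathcomp Require Import all_boot all_algebra.
From mathcomp Require Import sesquilinear boolp.

Set Implicit Arguments.
Unset Strict Implicit.
Unset Printing Implicit Defensive.

Import GRing.Theory.
Local Open Scope ring_scope.

(** Composing with powers of the structure automorphisms removes every twist.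
    Put a ∗ b = ξ^-1(ab) on an algebra, let a act on a module by
    x ↦ ξ^-1(a · x), and replace each coproduct or coaction by its composite
    with ξ ⊗ ξ.  The Hom-axioms become the ordinary axioms of a Hopf algebra H,
    an H-bicomodule algebra A and their (co)modules, all carrying an
    automorphism compatible with the operations.  The Yetter-Drinfeld condition
    and the product of the diagonal crossed product lose their twists as well.

    In this form both kinds of objects consist of the same data on (M, ξ): an
    action al of A and an action phi of the convolution algebra dual to H.
    - A coaction of H is the same thing as an action of the dual, by
      phi f x = f(x_1) x_0, because H is finite-dimensional ([comoduleP]).
    - The Yetter-Drinfeld condition says ([yd_compatP])
        phi f (al a x) = al a_00 (phi (S^-1(a_-1) ⇀ f ↼ a_01) x).
    - A module over the diagonal crossed product is a pair (phi, al), with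
      f ⋈ a acting as phi f composed with al a, which satisfies
        al a (phi f x) = phi (a_-1 ⇀ f ↼ S^-1(a_01)) (al a_00 x)
      ([diag_act_module], [parts_crossed_pair]).

    The two exchange rules are equivalent ([cross_leftP]).  Substituting one
    into the other coacts twice; coassociativity turns the two outer and the
    two inner legs into the coproducts of a_-1 and a_01, and these collapse by
    S^-1(h_2) h_1 = ε(h) = h_2 S^-1(h_1), the identities saying that S^-1 is an
    antipode for the opposite product ([bicoact_cancel]).

    Passing from one kind of object to the other keeps the underlying space,
    its automorphism and the underlying maps of morphisms, and the two passages
    undo each other on the structure maps; so they are inverse isomorphisms of
    categories. *)

(** * Multilinear expressions *)

Section LinearRules.
Variable k : fieldType.
Implicit Types U V W P : lmodType k.

Lemma lin_id U : linear (fun u : U => u). Proof. by []. Qed.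

Lemma lin_comp U V W (f : V -> W) (g : U -> V) :
  linear f -> linear g -> linear (fun u => f (g u)).
Proof. by move=> hf hg c u v; rewrite hg hf. Qed.

Lemma lin_app U V W (f : {linear V -> W}) (g : U -> V) :
  linear g -> linear (fun u => f (g u)).
Proof. by move=> hg c u v; rewrite hg linearP. Qed.

Lemma lin_bil1 U V V' W (b : {bilinear V -> V' -> W}) (g : U -> V) y :
  linear g -> linear (fun u => b (g u) y).
Proof. by move=> hg c u v; rewrite hg linearPl. Qed.

Lemma lin_bil2 U V V' W (b : {bilinear V -> V' -> W}) (g : U -> V') y :
  linear g -> linear (fun u => b y (g u)).
Proof. by move=> hg c u v; rewrite hg linearPr. Qed.

Lemma lin_tens1 U V V' (g : U -> V) (y : V') :
  linear g -> linear (fun u => g u ⊗ y).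
Proof. by move=> hg c u v; rewrite hg (tens_bilinear _ _).1. Qed.

Lemma lin_tens2 U V V' (g : U -> V') (y : V) :
  linear g -> linear (fun u => y ⊗ g u).
Proof. by move=> hg c u v; rewrite hg (tens_bilinear _ _).2. Qed.

Lemma lin_scale1 U W (g : U -> k^o) (w : W) :
  linear g -> linear (fun u => (g u : k) *: w).
Proof. by move=> hg c u v; rewrite hg scalerDl -scalerA. Qed.

Lemma lin_scale2 U W (g : U -> W) (c : k) :
  linear g -> linear (fun u => c *: g u).
Proof.
by move=> hg a u v; rewrite hg scalerDr !scalerA mulrC.
Qed.

Lemma lin_mul1 U (g : U -> k^o) (c : k) :
  linear g -> linear (fun u => (g u : k) * c : k^o).
Proof. by move=> hg a u v; rewrite hg mulrDl -mulrA. Qed.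

Lemma lin_mul2 U (g : U -> k^o) (c : k) :
  linear g -> linear (fun u => c * (g u : k) : k^o).
Proof.
by move=> hg a u v; rewrite hg mulrDr; congr (_ + _); apply: mulrCA.
Qed.

Lemma lin_hom1 U (V W : vectType k) (F : U -> 'Hom(V, W)) x :
  linear F -> linear (fun u => F u x).
Proof. by move=> hF c u v; rewrite hF add_lfunE scale_lfunE. Qed.

Lemma lin_hom2 U (V W : vectType k) (f : 'Hom(V, W)) (g : U -> V) :
  linear g -> linear (fun u => f (g u)).
Proof. by move=> hg c u v; rewrite hg linearP. Qed.

Lemma lin_tsum1 U V V' P (b : V -> V' -> P) (t : U -> tensor V V') :
  is_bilinear b -> linear t -> linear (fun u => tsum (t u) b).
Proof. by move=> hb ht c u v; rewrite ht tsum_linear. Qed.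

Lemma lin_tsum2 U V V' P (b : U -> V -> V' -> P) (t : tensor V V') :
  (forall x y, linear (fun u => b u x y)) -> linear (fun u => tsum t (b u)).
Proof. exact: tsum_fun_linear. Qed.

End LinearRules.

Ltac lin_hyp :=
  match goal with
  | h : GRing.linear_for _ _ |- _ => exact: h
  | h : forall _, GRing.linear_for _ _ |- _ => exact: h
  | h : forall _ _, GRing.linear_for _ _ |- _ => exact: h
  | h : forall _ _ _ _, GRing.linear_for _ _ |- _ => exact: h
  end.

(** Unification with the rules above produces eta-reduced maps such as
    [tens x], which have to be expanded before their head can be read. *)
Ltac lin_eta :=
  cbv beta;
  lazymatch goal with
  | |- GRing.linear_for _ (fun _ => _) => idtac
  | |- GRing.linear_for ?s ?f => change (GRing.linear_for s (fun u => f u))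
  end.

(** A Sweedler expression is multilinear because of its shape: each operation
    is linear in the argument containing the variable.  The last alternative
    goes below a multilinear map assumed in the context. *)
Ltac lin :=
  lazymatch goal with
  | |- is_bilinear _ => split; intro; lin
  | |- forall _, _ => intro; lin
  | |- _ => lin_eta; first [ lin_hyp | lin_step | lin_hyp_comp ]
  end
with lin_hyp_comp :=
  match goal with
  | h : forall _ _, GRing.linear_for _ _ |- _ => refine (lin_comp (h _ _) _); lin
  end
with lin_step :=
  lazymatch goal with
  | |- GRing.linear_for _ (fun u => u) => exact: lin_id
  | |- GRing.linear_for _ (fun u => tsum _ _) =>
      first [ refine (@lin_tsum2 _ _ _ _ _ _ _ _); intros ? ?; lin
            | refine (@lin_tsum1 _ _ _ _ _ _ _ _ _); lin ]
  | |- GRing.linear_for _ (fun u => Bilinear.sort _ _ _) =>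
      first [ refine (@lin_bil1 _ _ _ _ _ _ _ _ _); lin
            | refine (@lin_bil2 _ _ _ _ _ _ _ _ _); lin ]
  | |- GRing.linear_for _ (fun u => tens _ _) =>
      first [ refine (@lin_tens1 _ _ _ _ _ _ _); lin
            | refine (@lin_tens2 _ _ _ _ _ _ _); lin ]
  | |- GRing.linear_for _ (fun u => GRing.scale _ _) =>
      first [ refine (@lin_scale1 _ _ _ _ _ _); lin
            | refine (@lin_scale2 _ _ _ _ _ _); lin ]
  | |- GRing.linear_for _ (fun u => GRing.mul _ _) =>
      first [ refine (@lin_mul1 _ _ _ _ _); lin
            | refine (@lin_mul2 _ _ _ _ _); lin ]
  | |- GRing.linear_for _ (fun u => fun_of_lfun _ _) =>
      first [ refine (@lin_hom1 _ _ _ _ _ _ _); lin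
            | refine (@lin_hom2 _ _ _ _ _ _ _); lin ]
  | |- GRing.linear_for _ (fun u => GRing.Linear.sort _ _) =>
      refine (@lin_app _ _ _ _ _ _ _); lin
  end.

(** * Sweedler sums *)

Section SweedlerSums.
Variable k : fieldType.
Implicit Types M N P X Y Z : lmodType k.

Lemma linear_ofE M N (f : M -> N) (hf : linear f) x : linear_of hf x = f x.
Proof. by []. Qed.

Lemma linear_tens_ext M N P (F G : tensor M N -> P) :
  linear F -> linear G -> (forall x y, F (x ⊗ y) = G (x ⊗ y)) -> F =1 G.
Proof.
by move=> hF hG FG; apply: (tensor_ext (f := linear_of hF) (g := linear_of hG)).
Qed.

Lemma tsum_tsum M N X Y P (t : tensor M N) (c : M -> N -> tensor X Y)
    (b : X -> Y -> P) : is_bilinear b ->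
  tsum (tsum t c) b = \tsum_(x ⊗ y <- t) tsum (c x y) b.
Proof. by move=> hb; apply: (linear_tsum (linear_of (tsum_linear hb))). Qed.

Lemma tsum_scale M N P (t : tensor M N) (c : M -> N -> k) (p : P) :
  \tsum_(x ⊗ y <- t) (c x y *: p) = (\tsum_(x ⊗ y <- t) (c x y : k^o) : k) *: p.
Proof. by rewrite /tsum /tens_eval scaler_suml. Qed.

Lemma tsumZ M N P (t : tensor M N) (c : k) (b : M -> N -> P) :
  \tsum_(x ⊗ y <- t) (c *: b x y) = c *: tsum t b.
Proof. by rewrite /tsum /tens_eval scaler_sumr. Qed.

Lemma exchange_tsum M N X Y P (t : tensor M N) (u : tensor X Y)
    (T : M -> N -> X -> Y -> P) :
  \tsum_(x ⊗ y <- t) \tsum_(z ⊗ w <- u) T x y z w =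
  \tsum_(z ⊗ w <- u) \tsum_(x ⊗ y <- t) T x y z w.
Proof. by rewrite /tsum /tens_eval exchange_big. Qed.

Lemma tsum_tens_map M N X Y P (f : {linear M -> X}) (g : {linear N -> Y})
    (t : tensor M N) (b : X -> Y -> P) : is_bilinear b ->
  tsum (tens_map f g t) b = \tsum_(x ⊗ y <- t) b (f x) (g y).
Proof.
move=> hb; rewrite -[tens_map f g t]/(tsum t _) tsum_tsum //.
by apply: eq_tsum => x y; rewrite tsum_tens.
Qed.

Lemma linear_tsum_tens X Y P (L : {linear tensor X Y -> P}) t :
  L t = \tsum_(x ⊗ y <- t) L (x ⊗ y).
Proof. by rewrite -[t in LHS]tsum_id linear_tsum. Qed.

End SweedlerSums.

Section Trilinear.
Variables (k : fieldType) (X Y Z P : lmodType k) (T : X -> Y -> Z -> P).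

Definition is_trilinear :=
  [/\ forall y z, linear (fun x => T x y z), forall x z, linear (fun y => T x y z)
    & forall x y, linear (fun z => T x y z)].

Hypothesis hT : is_trilinear.

(** The axioms are identities in threefold tensor products.  Through this
    factorization any trilinear map can be applied to both sides of one. *)
Lemma trilinear_factors :
  {L : {linear tensor X (tensor Y Z) -> P} |
    forall x y z, L (x ⊗ (y ⊗ z)) = T x y z}.
Proof.
case: hT => h1 h2 h3.
have hb x : is_bilinear (T x) by split.
have hL : is_bilinear (fun x (t : tensor Y Z) => tsum t (T x)).
  split=> [t|x]; last by apply: lin_tsum1; [|exact: lin_id].
  by apply: lin_tsum2.
exists (linear_of (tsum_linear hL)) => x y z.
by rewrite -[LHS]/(tsum _ _) tsum_tens // tsum_tens.
Qed.

End Trilinear.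

(** * Slices along a finite-dimensional factor *)

Section Slices.
Variables (k : fieldType) (M : lmodType k) (H : vectType k).
Local Notation Hd := 'Hom(H, k^o).
Local Notation e := (vbasis (fullv : {vspace H})).

Definition dual_basis (i : 'I_(\dim (fullv : {vspace H}))) : Hd :=
  linfun (coord e i : H -> k^o).

Lemma dual_basisK (h : H) : h = \sum_i (dual_basis i h : k) *: e`_i.
Proof.
rewrite [LHS](coord_vbasis (memvf h)).
by apply: eq_bigr => i _; rewrite dual_coordE.
Qed.

Lemma slice_basis (t : tensor M H) :
  t = \sum_i (\tsum_(m ⊗ h <- t) ((dual_basis i h : k) *: m)) ⊗ e`_i.
Proof.
elim/tens_ind: t => [|m h t IH].
  rewrite big1 // => i _; rewrite /tsum.
  set F := fun t : tensor M H => tsum t (fun m h => (dual_basis i h : k) *: m).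
  have hF : linear F by rewrite /F; lin.
  by rewrite -[tens_eval _ _]/(linear_of hF 0) linear0 tens0l.
rewrite {1}IH {1}(dual_basisK h).
have -> : m ⊗ (\sum_i (dual_basis i h : k) *: e`_i) =
    \sum_i ((dual_basis i h : k) *: m) ⊗ e`_i :> tensor M H.
  rewrite -[LHS]/(bilinear_of (tens_bilinear _ _) m _) linear_sumr.
  by apply: eq_bigr => i _; rewrite linearZr_LR /= tensZl.
rewrite -big_split; apply: eq_bigr => i _ /=; rewrite -tensDl.
set F := fun t : tensor M H => tsum t (fun m h => (dual_basis i h : k) *: m).
have hF : linear F by rewrite /F; lin.
rewrite -[tsum _ _ in RHS]/(linear_of hF (_ + _)) linearD; congr ((_ + _) ⊗ _).
by rewrite -[RHS]/(tsum _ _) tsum_tens //; lin.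
Qed.

(** Functionals on a finite-dimensional space separate tensors: t is recovered
    from its slices along the dual basis. *)
Lemma slice_inj (t u : tensor M H) :
  (forall f : Hd, \tsum_(m ⊗ h <- t) ((f h : k) *: m) =
                  \tsum_(m ⊗ h <- u) ((f h : k) *: m)) -> t = u.
Proof.
move=> tu; rewrite [t]slice_basis [u]slice_basis.
by apply: eq_bigr => i _; rewrite tu.
Qed.

End Slices.

Section DoubleSlices.
Variables (k : fieldType) (M : lmodType k) (H : vectType k).
Local Notation Hd := 'Hom(H, k^o).

Lemma slice2_inj (t u : tensor M (tensor H H)) :
  (forall f g : Hd,
     \tsum_(m ⊗ s <- t) \tsum_(x ⊗ y <- s) (((f x : k) * g y) *: m) =
     \tsum_(m ⊗ s <- u) \tsum_(x ⊗ y <- s) (((f x : k) * g y) *: m)) ->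
  t = u.
Proof.
have hb (g : Hd) : is_bilinear (fun m (s : tensor H H) =>
    m ⊗ (\tsum_(x ⊗ y <- s) ((g y : k) *: x)) : tensor M H) by lin.
pose F (g : Hd) := linear_of (tsum_linear (hb g)).
pose e := vbasis (fullv : {vspace H}).
have tE (t' : tensor M (tensor H H)) :
    t' = \sum_i \tsum_(m ⊗ h <- F (dual_basis i) t') (m ⊗ (h ⊗ e`_i)).
  have hF i : linear (fun w => \tsum_(m ⊗ h <- F (dual_basis i) w)
      (m ⊗ (h ⊗ e`_i) : tensor M (tensor H H))) by lin.
  have hS : linear (fun w => \sum_i \tsum_(m ⊗ h <- F (dual_basis i) w)
      (m ⊗ (h ⊗ e`_i) : tensor M (tensor H H))).
    move=> c a b; rewrite scaler_sumr -big_split; apply: eq_bigr => i _.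
    by rewrite hF.
  apply: (linear_tens_ext _ hS); first exact: lin_id.
  move=> m s; rewrite {1}(slice_basis s).
  rewrite -[LHS]/(bilinear_of (tens_bilinear _ _) m _) linear_sumr.
  apply: eq_bigr => i _ /=.
  by rewrite -[F _ _]/(tsum _ _) (tsum_tens _ _ (hb _)) tsum_tens //; lin.
move=> tu; rewrite [t]tE [u]tE; apply: eq_bigr => i _; congr (tsum _ _).
apply: slice_inj => f.
have FE (t' : tensor M (tensor H H)) : \tsum_(m ⊗ h <- F (dual_basis i) t')
    ((f h : k) *: m) = \tsum_(m ⊗ s <- t') \tsum_(x ⊗ y <- s)
      (((f x : k) * dual_basis i y) *: m).
  rewrite -[F _ _]/(tsum _ _) tsum_tsum; last by lin.
  apply: eq_tsum => m s; rewrite tsum_tens; last by lin.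
  rewrite linear_tsum tsum_scale; congr (_ *: _); apply: eq_bigr => p _.
  by rewrite linearZ mulrC.
by rewrite !FE.
Qed.

End DoubleSlices.

Local Opaque aut_inv.

(** * Untwisting *)

Section UntwistOperations.
Variable k : fieldType.
Implicit Types U V W X Y Z P : lmodType k.

Lemma untw_op_bilinear U V W (xi : hom_aut W) (b : {bilinear U -> V -> W}) :
  is_bilinear (fun x y => aut_inv xi (b x y)).
Proof. lin. Qed.

(** For a product on W this is a ∗ b = ξ^-1(ab); for an action, the ordinary
    action underlying a Hom-action. *)
Definition untw_op U V W (xi : hom_aut W) (b : {bilinear U -> V -> W}) :
    {bilinear U -> V -> W} :=
  bilinear_of (untw_op_bilinear xi b).

Lemma untw_opE U V W (xi : hom_aut W) (b : {bilinear U -> V -> W}) x y :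
  b x y = xi (untw_op xi b x y).
Proof. by rewrite -[untw_op _ _ _ _]/(aut_inv xi _) aut_invKV. Qed.

(** Dually to [untw_op], an ordinary coproduct or coaction is (ξ ⊗ ξ) after the
    given one. *)
Definition untw_coop V X Y (xiX : hom_aut X) (xiY : hom_aut Y)
    (d : {linear V -> tensor X Y}) : {linear V -> tensor X Y} :=
  tens_map xiX xiY \o d.

Lemma tsum_untw V X Y W (xiX : hom_aut X) (xiY : hom_aut Y)
    (d : {linear V -> tensor X Y}) (b : X -> Y -> W) v : is_bilinear b ->
  tsum (untw_coop xiX xiY d v) b =
  \tsum_(x ⊗ y <- d v) b (xiX x) (xiY y).
Proof. by move=> hb; apply: tsum_tens_map. Qed.

Lemma untw_coop_xi V X Y (xiV : hom_aut V) (xiX : hom_aut X) (xiY : hom_aut Y)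
    (d : {linear V -> tensor X Y}) v :
  (forall u, d (xiV u) = \tsum_(x ⊗ y <- d u) (xiX x ⊗ xiY y)) ->
  untw_coop xiX xiY d v = d (xiV v).
Proof. by move->. Qed.

(** Coassociativity of the coproduct, of a left or right coaction, and the
    compatibility of the two coactions on A are all instances of one identity
    between two ways of coacting twice; it is untwisted here once for all.
    Being tested on trilinear maps, it is ready for use inside Sweedler sums. *)
Lemma untw_coassoc V X Y Z X1 X2 (P : lmodType k)
    (xiX : hom_aut X) (xiX1 : hom_aut X1) (xiX2 : hom_aut X2)
    (xiY : hom_aut Y) (xiZ : hom_aut Z)
    (d : {linear V -> tensor X Y}) (d' : {linear X -> tensor X1 X2})
    (c : {linear V -> tensor X1 Z}) (c' : {linear Z -> tensor X2 Y}) :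
  (forall x, d' (xiX x) = \tsum_(x1 ⊗ x2 <- d' x) (xiX1 x1 ⊗ xiX2 x2)) ->
  (forall z, c' (xiZ z) = \tsum_(x2 ⊗ y <- c' z) (xiX2 x2 ⊗ xiY y)) ->
  (forall v, \tsum_(x ⊗ y <- d v) \tsum_(x1 ⊗ x2 <- d' x)
      (x1 ⊗ (x2 ⊗ aut_inv xiY y)) =
    \tsum_(x1 ⊗ z <- c v) (aut_inv xiX1 x1 ⊗ c' z)) ->
  forall v (T : X1 -> X2 -> Y -> P), is_trilinear T ->
  \tsum_(x ⊗ y <- untw_coop xiX xiY d v)
    \tsum_(x1 ⊗ x2 <- untw_coop xiX1 xiX2 d' x) T x1 x2 y =
  \tsum_(x1 ⊗ z <- untw_coop xiX1 xiZ c v)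
    \tsum_(x2 ⊗ y <- untw_coop xiX2 xiY c' z) T x1 x2 y.
Proof.
move=> hd' hc' h v T hT.
have [L LE] := trilinear_factors hT.
have xx (W : lmodType k) (xi : hom_aut W) : linear (xi \o xi).
  by move=> ? ? ?; rewrite /= !linearP.
(* A leg split off by the inner map receives one automorphism from that map
   and one from the outer map, moved past the inner one; the remaining leg
   receives one, which is ξ^2 of the ξ^-1 present in the axiom.  Hence both
   sides are the axiom evaluated through ξ^2 on every leg. *)
pose sq (W : lmodType k) (xi : hom_aut W) : {linear W -> W} := linear_of (xx _ xi).
pose L2 : {linear tensor X1 (tensor X2 Y) -> P} :=
  L \o tens_map (sq _ xiX1) (tens_map (sq _ xiX2) (sq _ xiY)).
have L2E x1 x2 y : L2 (x1 ⊗ (x2 ⊗ y)) =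
    L (xiX1 (xiX1 x1) ⊗ (xiX2 (xiX2 x2) ⊗ xiY (xiY y))).
  by rewrite -[LHS]/(L (tens_map _ _ _)) !tens_mapE.
transitivity (\tsum_(x ⊗ y <- untw_coop xiX xiY d v)
    \tsum_(x1 ⊗ x2 <- untw_coop xiX1 xiX2 d' x) L (x1 ⊗ (x2 ⊗ y))).
  by do 2!apply: eq_tsum => ? ?; rewrite LE.
transitivity (\tsum_(x1 ⊗ z <- untw_coop xiX1 xiZ c v)
    \tsum_(x2 ⊗ y <- untw_coop xiX2 xiY c' z) L (x1 ⊗ (x2 ⊗ y))); last first.
  by do 2!apply: eq_tsum => ? ?; rewrite LE.
have /(congr1 L2) := h v; rewrite !linear_tsum => hv.
rewrite tsum_untw; last by lin.
rewrite [RHS]tsum_untw; last by lin.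
transitivity (\tsum_(x ⊗ y <- d v) L2 (\tsum_(x1 ⊗ x2 <- d' x)
    (x1 ⊗ (x2 ⊗ aut_inv xiY y)))).
  apply: eq_tsum => x y; rewrite linear_tsum tsum_untw; last by lin.
  rewrite hd' tsum_tsum; last by lin.
  apply: eq_tsum => x1 x2; rewrite tsum_tens; last by lin.
  by rewrite L2E aut_invKV.
rewrite hv; apply: eq_tsum => x1 z.
rewrite tsum_untw; last by lin.
rewrite hc' tsum_tsum; last by lin.
have hx : linear (fun t => L2 (aut_inv xiX1 x1 ⊗ t)) by lin.
rewrite -[LHS]/(linear_of hx _) linear_tsum_tens; apply: eq_tsum => x2 y.
rewrite tsum_tens; last by lin.
by rewrite -[LHS]/(L2 _) L2E aut_invKV.
Qed.

Lemma untw_counitr V Y P (xiV : hom_aut V) (xiY : hom_aut Y)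
    (d : {linear V -> tensor V Y}) (eps : {linear Y -> k^o}) :
  (forall y, eps (xiY y) = eps y) ->
  (forall v, \tsum_(x ⊗ y <- d v) (eps y *: x) = aut_inv xiV v) ->
  forall v (f : V -> P), linear f ->
  \tsum_(x ⊗ y <- untw_coop xiV xiY d v) ((eps y : k) *: f x) = f v.
Proof.
move=> heps h v f hf; rewrite tsum_untw; last by lin.
transitivity (linear_of hf (xiV (\tsum_(x ⊗ y <- d v) (eps y *: x)))).
  by rewrite !linear_tsum; apply: eq_tsum => x y; rewrite !linearZ heps.
by rewrite h aut_invKV.
Qed.

Lemma untw_counitl V Y P (xiV : hom_aut V) (xiY : hom_aut Y)
    (d : {linear V -> tensor Y V}) (eps : {linear Y -> k^o}) :
  (forall y, eps (xiY y) = eps y) ->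
  (forall v, \tsum_(y ⊗ x <- d v) (eps y *: x) = aut_inv xiV v) ->
  forall v (f : V -> P), linear f ->
  \tsum_(y ⊗ x <- untw_coop xiY xiV d v) ((eps y : k) *: f x) = f v.
Proof.
move=> heps h v f hf; rewrite tsum_untw; last by lin.
transitivity (linear_of hf (xiV (\tsum_(y ⊗ x <- d v) (eps y *: x)))).
  by rewrite !linear_tsum; apply: eq_tsum => x y; rewrite !linearZ heps.
by rewrite h aut_invKV.
Qed.

End UntwistOperations.

(** * The underlying Hopf algebra *)

Section UntwistedAlgebra.
Variables (k : fieldType) (A : lmodType k) (xi : hom_aut A).
Variable hA : hom_algebra xi.

Definition umul : {bilinear A -> A -> A} := untw_op xi (hmul hA).
Local Notation "a '∗' b" := (umul a b) (at level 38, left associativity).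
Local Notation "'𝟙'" := (hone hA).

Lemma hmulE a b : hmul hA a b = xi (a ∗ b).
Proof. exact: untw_opE. Qed.

Lemma umul_xi a b : xi (a ∗ b) = xi a ∗ xi b.
Proof.
apply: (can_inj (aut_invK xi)) => /=.
by rewrite -!hmulE (ha_xiM (ha_ax hA)).
Qed.

Lemma umul_inv a b : aut_inv xi (a ∗ b) = aut_inv xi a ∗ aut_inv xi b.
Proof. by apply: (can_inj (aut_invK xi)); rewrite umul_xi !aut_invKV. Qed.

Lemma umulA a b c : a ∗ (b ∗ c) = a ∗ b ∗ c.
Proof.
apply: (can_inj (aut_invK xi)); apply: (can_inj (aut_invK xi)).
have := ha_assoc (ha_ax hA) a b c.
by rewrite !hmulE -!umul_xi.
Qed.

Lemma umul1 a : a ∗ 𝟙 = a.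
Proof.
by apply: (can_inj (aut_invK xi)); rewrite -hmulE (ha_mul1 (ha_ax hA)).
Qed.

Lemma u1mul a : 𝟙 ∗ a = a.
Proof.
by apply: (can_inj (aut_invK xi)); rewrite -hmulE (ha_1mul (ha_ax hA)).
Qed.

End UntwistedAlgebra.

Section UntwistedHopf.
Variables (k : fieldType) (H : lmodType k) (xi : hom_aut H) (hH : hom_hopf xi).

Local Notation "a '∗' b" := (umul hH a b) (at level 38, left associativity).
Local Notation "'𝟙'" := (hone hH).
Local Notation S := (antipode hH).
Local Notation eps := (heps hH).

Definition ucomul : {linear H -> tensor H H} := untw_coop xi xi (hDelta hH).
Local Notation D := ucomul.

Lemma ucomulE h : D h = hDelta hH (xi h).
Proof. exact/untw_coop_xi/hc_Delta_xi. Qed.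

Lemma ucoassoc (P : lmodType k) (T : H -> H -> H -> P) h : is_trilinear T ->
  \tsum_(x ⊗ y <- D h) \tsum_(x1 ⊗ x2 <- D x) T x1 x2 y =
  \tsum_(x ⊗ y <- D h) \tsum_(y1 ⊗ y2 <- D y) T x y1 y2.
Proof.
apply: untw_coassoc; [exact: hc_Delta_xi | exact: hc_Delta_xi |].
by move=> v; rewrite hc_coassoc.
Qed.

Lemma ucounitr (P : lmodType k) (f : H -> P) h : linear f ->
  \tsum_(x ⊗ y <- D h) ((eps y : k) *: f x) = f h.
Proof. exact: untw_counitr (hc_eps_xi hH) (hc_counitr hH) h f. Qed.

Lemma ucounitl (P : lmodType k) (f : H -> P) h : linear f ->
  \tsum_(x ⊗ y <- D h) ((eps x : k) *: f y) = f h.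
Proof. exact: untw_counitl (hc_eps_xi hH) (hc_counitl hH) h f. Qed.

Lemma tsum_ucomulM (P : lmodType k) (b : H -> H -> P) g h : is_bilinear b ->
  tsum (D (g ∗ h)) b =
  \tsum_(g1 ⊗ g2 <- D g) \tsum_(h1 ⊗ h2 <- D h) b (g1 ∗ h1) (g2 ∗ h2).
Proof.
move=> hb; rewrite ucomulE -hmulE hh_DeltaM tsum_tsum //.
rewrite tsum_untw; last first.
  split=> [y|x]; apply: lin_tsum2 => h1 h2.
    by move=> c u v; rewrite linearPl hb.1.
  by move=> c u v; rewrite linearPl hb.2.
apply: eq_tsum => g1 g2; rewrite tsum_tsum // tsum_untw; last first.
  split=> [y|x] c u v; first by rewrite linearPr hb.1.
  by rewrite linearPr hb.2.
apply: eq_tsum => h1 h2; rewrite tsum_tens //.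
by rewrite !hmulE !umul_xi.
Qed.

Lemma ucomul1 : D 𝟙 = 𝟙 ⊗ 𝟙.
Proof. by rewrite ucomulE (ha_xi1 (ha_ax hH)) hh_Delta1. Qed.

Lemma heps_umul g h : eps (g ∗ h) = (eps g : k) * eps h.
Proof. by rewrite -hh_epsM hmulE hc_eps_xi. Qed.

Lemma uantipodel h : \tsum_(x ⊗ y <- D h) (S x ∗ y) = (eps h : k) *: 𝟙.
Proof.
rewrite -hh_Sl tsum_untw; last by lin.
by apply: eq_tsum => x y; rewrite hh_S_xi -umul_xi -hmulE.
Qed.

Lemma uantipoder h : \tsum_(x ⊗ y <- D h) (x ∗ S y) = (eps h : k) *: 𝟙.
Proof.
rewrite -hh_Sr tsum_untw; last by lin.
by apply: eq_tsum => x y; rewrite hh_S_xi -umul_xi -hmulE.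
Qed.

Lemma antipode1 : S 𝟙 = 𝟙.
Proof.
have := uantipodel 𝟙; rewrite ucomul1 tsum_tens; last by lin.
by rewrite umul1 hh_eps1 scale1r.
Qed.

Lemma heps_antipode h : eps (S h) = eps h.
Proof.
have /(congr1 eps) := uantipodel h.
rewrite linear_tsum linearZ hh_eps1 => e.
transitivity (eps h * 1 : k); last by rewrite mulr1.
rewrite -[RHS]e -[LHS](ucounitr h (f := fun x => eps (S x))); last by lin.
by apply: eq_tsum => x y; rewrite heps_umul mulrC.
Qed.

(** S(gh) and S(h)S(g) are a left and a right convolution inverse of the product
    H ⊗ H -> H.  Both are therefore the value of
    S(g_1 h_1) ((g_2 h_2) (S(h_3) S(g_3))), bracketed in the two possible ways. *)
Lemma antipodeM g h : S (g ∗ h) = S h ∗ S g.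
Proof.
have inner1 g' h' : \tsum_(g2 ⊗ g3 <- D g') \tsum_(h2 ⊗ h3 <- D h')
    ((g2 ∗ h2) ∗ (S h3 ∗ S g3)) = ((eps g' : k) * eps h') *: 𝟙.
  transitivity (\tsum_(g2 ⊗ g3 <- D g') ((eps h' : k) *: (g2 ∗ S g3))).
    apply: eq_tsum => g2 g3.
    have hl : linear (fun x => g2 ∗ (x ∗ S g3)) by lin.
    transitivity (linear_of hl (\tsum_(h2 ⊗ h3 <- D h') (h2 ∗ S h3))).
      rewrite linear_tsum; apply: eq_tsum => h2 h3.
      by rewrite -[RHS]/(g2 ∗ (h2 ∗ S h3 ∗ S g3)) !umulA.
    by rewrite uantipoder linearZ_LR linear_ofE u1mul.
  by rewrite tsumZ uantipoder scalerA mulrC.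
have inner2 g' h' : \tsum_(g1 ⊗ g2 <- D g') \tsum_(h1 ⊗ h2 <- D h')
    (S (g1 ∗ h1) ∗ (g2 ∗ h2)) = ((eps g' : k) * eps h') *: 𝟙.
  rewrite -(@tsum_ucomulM _ (fun x y => S x ∗ y)); last by lin.
  by rewrite uantipodel heps_umul.
transitivity (\tsum_(g1 ⊗ g' <- D g) \tsum_(h1 ⊗ h' <- D h)
   \tsum_(g2 ⊗ g3 <- D g') \tsum_(h2 ⊗ h3 <- D h')
   (S (g1 ∗ h1) ∗ ((g2 ∗ h2) ∗ (S h3 ∗ S g3)))).
  rewrite -[LHS](ucounitr g (f := fun x => S (x ∗ h))); last by lin.
  apply: eq_tsum => g1 g'.
  rewrite -[LHS](ucounitr h (f := fun x => (eps g' : k) *: S (g1 ∗ x)));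
    last by lin.
  apply: eq_tsum => h1 h'.
  have hl : linear (fun x => S (g1 ∗ h1) ∗ x) by lin.
  transitivity (linear_of hl (((eps g' : k) * eps h') *: 𝟙)).
    by rewrite [in RHS]linearZ_LR linear_ofE umul1 scalerA mulrC.
  rewrite -inner1 linear_tsum; apply: eq_tsum => g2 g3.
  by rewrite linear_tsum.
(* Splitting g and h from the left instead lets the first two legs cancel. *)
transitivity (\tsum_(x ⊗ g3 <- D g) \tsum_(y ⊗ h3 <- D h)
   \tsum_(g1 ⊗ g2 <- D x) \tsum_(h1 ⊗ h2 <- D y)
   (S (g1 ∗ h1) ∗ ((g2 ∗ h2) ∗ (S h3 ∗ S g3)))); last first.
  rewrite -[RHS](ucounitl g (f := fun x => S h ∗ S x)); last by lin.
  apply: eq_tsum => x g3.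
  rewrite -[RHS](ucounitl h (f := fun y => (eps x : k) *: (S y ∗ S g3)));
    last by lin.
  apply: eq_tsum => y h3.
  have hl : linear (fun x => x ∗ (S h3 ∗ S g3)) by lin.
  transitivity (linear_of hl (((eps x : k) * eps y) *: 𝟙)).
    rewrite -inner2 linear_tsum; apply: eq_tsum => g1 g2.
    rewrite linear_tsum; apply: eq_tsum => h1 h2.
    by rewrite -[RHS]/(_ ∗ _ ∗ (S h3 ∗ S g3)) !umulA.
  by rewrite linearZ_LR linear_ofE u1mul scalerA mulrC.
transitivity (\tsum_(g1 ⊗ g' <- D g) \tsum_(g2 ⊗ g3 <- D g')
   \tsum_(h1 ⊗ h' <- D h) \tsum_(h2 ⊗ h3 <- D h')
   (S (g1 ∗ h1) ∗ ((g2 ∗ h2) ∗ (S h3 ∗ S g3)))).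
  by apply: eq_tsum => g1 g'; rewrite exchange_tsum.
rewrite -(@ucoassoc _ (fun g1 g2 g3 => \tsum_(h1 ⊗ h' <- D h)
   \tsum_(h2 ⊗ h3 <- D h') (S (g1 ∗ h1) ∗ ((g2 ∗ h2) ∗ (S h3 ∗ S g3)))));
  last by split; lin.
apply: eq_tsum => x g3; rewrite [RHS]exchange_tsum; apply: eq_tsum => g1 g2.
by rewrite -(@ucoassoc _ (fun h1 h2 h3 =>
  S (g1 ∗ h1) ∗ ((g2 ∗ h2) ∗ (S h3 ∗ S g3)))); last by split; lin.
Qed.

Section Inverse.
Hypothesis bS : bijective S.
Local Notation S' := (linv bS).

Lemma antipode_inv_xi h : S' (xi h) = xi (S' h).
Proof. by apply: (bij_inj bS); rewrite hh_S_xi !linvKV. Qed.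

Lemma antipode_inv1 : S' 𝟙 = 𝟙.
Proof. by apply: (bij_inj bS); rewrite linvKV antipode1. Qed.

Lemma heps_antipode_inv h : eps (S' h) = eps h.
Proof. by rewrite -[RHS](congr1 eps (linvKV bS h)) heps_antipode. Qed.

(** S^-1 is an antipode for the opposite product: apply S, which reverses
    products, and the antipode axiom remains. *)
Lemma antipode_invl h : \tsum_(x ⊗ y <- D h) (S' y ∗ x) = (eps h : k) *: 𝟙.
Proof.
apply: (bij_inj bS); rewrite linear_tsum linearZ /= antipode1 -uantipodel.
by apply: eq_tsum => x y; rewrite antipodeM linvKV.
Qed.

Lemma antipode_invr h : \tsum_(x ⊗ y <- D h) (y ∗ S' x) = (eps h : k) *: 𝟙.
Proof.
apply: (bij_inj bS); rewrite linear_tsum linearZ /= antipode1 -uantipoder.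
by apply: eq_tsum => x y; rewrite antipodeM linvKV.
Qed.

End Inverse.
End UntwistedHopf.

(** * The dual algebra and its regular bimodule structure *)

Section UntwistedDual.
Variables (k : fieldType) (H : vectType k) (xi : hom_aut H) (hH : hom_hopf xi).
Local Notation Hd := 'Hom(H, k^o).
Local Notation "a '∗' b" := (umul hH a b) (at level 38, left associativity).
Local Notation "'𝟙'" := (hone hH).
Local Notation D := (ucomul hH).

Lemma conv_bilinear : is_bilinear (fun f g => xi_star xi (dual_mul hH f g)).
Proof. lin. Qed.

(** The structure automorphism of the dual is [xi_dual], so its inverse
    [xi_star] is what untwists the product. *)
Definition conv : {bilinear Hd -> Hd -> Hd} := bilinear_of conv_bilinear.

Lemma dual_mul_conv f g : dual_mul hH f g = xi_dual xi (conv f g).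
Proof. by rewrite -[conv f g]/(xi_star xi _) aut_invK. Qed.

Lemma convE f g h : conv f g h = \tsum_(x ⊗ y <- D h) ((f x : k) * g y : k^o).
Proof.
rewrite -[conv f g]/(xi_star xi _) xi_starE.
by rewrite -[dual_mul _ _ _]/(dual_mul_fun _ _ _) dual_mulE ucomulE.
Qed.

Lemma xi_dual_xi (f : Hd) h : xi_dual xi f (xi h) = f h.
Proof. by rewrite -[in RHS](aut_invK xi h); apply: xi_dualE. Qed.

Lemma dual_oneE h : dual_one hH h = heps hH h.
Proof. by apply: linfunE; lin. Qed.

Lemma dual_one_xi : xi_dual xi (dual_one hH) = dual_one hH.
Proof.
by apply/lfunP => h; rewrite -(aut_invKV xi h) xi_dual_xi !dual_oneE hc_eps_xi.
Qed.

Lemma conv1f f : conv (dual_one hH) f = f.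
Proof.
apply/lfunP => h; rewrite convE -[RHS](ucounitl hH h (f := f)); last by lin.
by apply: eq_tsum => x y; rewrite dual_oneE.
Qed.

Lemma convf1 f : conv f (dual_one hH) = f.
Proof.
apply/lfunP => h; rewrite convE -[RHS](ucounitr hH h (f := f)); last by lin.
by apply: eq_tsum => x y; rewrite dual_oneE mulrC.
Qed.

Lemma lreg_bilinear :
  is_bilinear (fun (u : H) (f : Hd) => linfun (fun l => f (l ∗ u)) : Hd).
Proof. by split=> ?; apply: linfun_linear => ?; lin. Qed.

Lemma rreg_bilinear :
  is_bilinear (fun (v : H) (f : Hd) => linfun (fun l => f (v ∗ l)) : Hd).
Proof. by split=> ?; apply: linfun_linear => ?; lin. Qed.

(** The regular actions u ⇀ f and f ↼ v. *)
Definition lreg : {bilinear H -> Hd -> Hd} := bilinear_of lreg_bilinear.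
Definition rreg : {bilinear H -> Hd -> Hd} := bilinear_of rreg_bilinear.

Local Notation translate u v f := (lreg u (rreg v f)).

Lemma translateE u v f l : translate u v f l = f (v ∗ l ∗ u).
Proof. by rewrite -umulA; do 2![apply: etrans (linfunE _ _) _; first by lin]. Qed.

Lemma translate1 f : translate 𝟙 𝟙 f = f.
Proof. by apply/lfunP => l; rewrite translateE u1mul umul1. Qed.

Lemma translateM u v u' v' f :
  translate u' v' (translate u v f) = translate (u' ∗ u) (v ∗ v') f.
Proof. by apply/lfunP => l; rewrite !translateE !umulA. Qed.

Lemma hitlE h f l : hitl hH h f l = f (aut_inv xi l ∗ h).
Proof.
have hl : linear (fun g : Hd => g l : k^o) by lin.
rewrite -[LHS]/(linear_of hl _) linear_tsum.
transitivity (\tsum_(f1 ⊗ f2 <- dual_coprod hH f)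
    ((f1 (aut_inv xi (aut_inv xi l)) : k) * f2 (aut_inv xi h) : k^o)).
  apply: eq_tsum => f1 f2; rewrite linearZ_LR linear_ofE -/(xi_dual xi).
  by rewrite !xi_dualE; apply: mulrC.
by rewrite dual_coprodP hmulE -umul_inv aut_invKV.
Qed.

Lemma hitrE h f l : hitr hH f h l = f (h ∗ aut_inv xi l).
Proof.
have hl : linear (fun g : Hd => g l : k^o) by lin.
rewrite -[LHS]/(linear_of hl _) linear_tsum.
transitivity (\tsum_(f1 ⊗ f2 <- dual_coprod hH f)
    ((f1 (aut_inv xi h) : k) * f2 (aut_inv xi (aut_inv xi l)) : k^o)).
  apply: eq_tsum => f1 f2; rewrite linearZ_LR linear_ofE -/(xi_dual xi).
  by rewrite !xi_dualE.
by rewrite dual_coprodP hmulE -umul_inv aut_invKV.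
Qed.

(** The harpoons turn the legs of the twisted coactions into those of the
    untwisted ones, which differ by ξ on a_-1 and by ξ^2 on a_01. *)
Lemma hit_translate u v f :
  hitl hH u (hitr hH (xi_star xi (xi_star xi f)) v) =
  translate (xi u) (xi (xi v)) f.
Proof.
apply/lfunP => l; rewrite hitlE hitrE translateE !xi_starE.
by rewrite !umul_inv !umul_xi !aut_invKV umulA.
Qed.

Lemma translate_one u v :
  translate u v (dual_one hH) =
  ((heps hH u : k) * heps hH v) *: dual_one hH.
Proof.
apply/lfunP => l; rewrite translateE scale_lfunE !dual_oneE !heps_umul.
by rewrite mulrC mulrA.
Qed.

End UntwistedDual.

(** The functional u ⇀ f ↼ v, that is l ↦ f(v l u). *)
Notation translate hH u v f := (lreg hH u (rreg hH v f)).

(** * The two-sided coaction *)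

Section Bicoaction.
Variables (k : fieldType) (H : lmodType k) (xiH : hom_aut H).
Variables (hH : hom_hopf xiH) (A : lmodType k) (xiA : hom_aut A).
Variable hA : hom_bicomod_algebra hH xiA.
Local Notation "a '∗' b" := (umul hH a b) (at level 38, left associativity).
Local Notation D := (ucomul hH).
Local Notation eps := (heps hH).

Definition lcoact : {linear A -> tensor H A} := untw_coop xiH xiA (rho_l hA).
Definition rcoact : {linear A -> tensor A H} := untw_coop xiA xiH (rho_r hA).
Local Notation L := lcoact.
Local Notation R := rcoact.

Lemma lcoassoc (P : lmodType k) (T : H -> H -> A -> P) a : is_trilinear T ->
  \tsum_(u ⊗ b <- L a) \tsum_(u1 ⊗ u2 <- D u) T u1 u2 b =
  \tsum_(u ⊗ b <- L a) \tsum_(u' ⊗ c <- L b) T u u' c.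
Proof.
apply: untw_coassoc; [exact: hc_Delta_xi | exact: lc_xi (ba_left hA) |].
exact: lc_coassoc (ba_left hA).
Qed.

Lemma rcoassoc (P : lmodType k) (T : A -> H -> H -> P) a : is_trilinear T ->
  \tsum_(b ⊗ v <- R a) \tsum_(c ⊗ v' <- R b) T c v' v =
  \tsum_(b ⊗ v <- R a) \tsum_(v1 ⊗ v2 <- D v) T b v1 v2.
Proof.
apply: untw_coassoc; [exact: rc_xi (ba_right hA) | exact: hc_Delta_xi |].
by move=> x; rewrite (rc_coassoc (ba_right hA)).
Qed.

Lemma bicoassoc (P : lmodType k) (T : H -> A -> H -> P) a : is_trilinear T ->
  \tsum_(b ⊗ v <- R a) \tsum_(u ⊗ c <- L b) T u c v =
  \tsum_(u ⊗ b <- L a) \tsum_(c ⊗ v <- R b) T u c v.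
Proof.
apply: untw_coassoc;
  [exact: lc_xi (ba_left hA) | exact: rc_xi (ba_right hA) | exact: ba_compat].
Qed.

Lemma lcounit (P : lmodType k) (f : A -> P) a : linear f ->
  \tsum_(u ⊗ b <- L a) ((eps u : k) *: f b) = f a.
Proof.
exact: untw_counitl (hc_eps_xi hH) (lc_counit (ba_left hA)) a f.
Qed.

Lemma rcounit (P : lmodType k) (f : A -> P) a : linear f ->
  \tsum_(b ⊗ v <- R a) ((eps v : k) *: f b) = f a.
Proof.
exact: untw_counitr (hc_eps_xi hH) (rc_counit (ba_right hA)) a f.
Qed.

(** The value of T on a_-1 ⊗ a_00 ⊗ a_01, the left coaction being taken first. *)
Definition bicoact (P : lmodType k) (a : A) (T : H -> A -> H -> P) : P :=
  \tsum_(u ⊗ b <- L a) \tsum_(c ⊗ v <- R b) T u c v.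

Lemma eq_bicoact (P : lmodType k) a (T T' : H -> A -> H -> P) :
  (forall u c v, T u c v = T' u c v) -> bicoact a T = bicoact a T'.
Proof. by move=> TT'; do 2!apply: eq_tsum => ? ?. Qed.

Lemma linear_bicoact (P Q : lmodType k) (f : P -> Q) a (T : H -> A -> H -> P) :
  linear f -> f (bicoact a T) = bicoact a (fun u c v => f (T u c v)).
Proof.
move=> hf; rewrite -[f _]/(linear_of hf _) linear_tsum.
by apply: eq_tsum => u b; rewrite linear_tsum.
Qed.

Lemma bicoactE (P : lmodType k) a (T : H -> A -> H -> P) : is_trilinear T ->
  bicoact a T = \tsum_(u ⊗ b <- rho_l hA a) \tsum_(c ⊗ v <- rho_r hA b)
    T (xiH u) (xiA (xiA c)) (xiH (xiH v)).
Proof.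
case=> h1 h2 h3; rewrite /bicoact tsum_untw; last by lin.
apply: eq_tsum => u b; rewrite tsum_untw; last by lin.
rewrite (rc_xi (ba_right hA)) tsum_tsum; last first.
  by lin.
apply: eq_tsum => c v; rewrite tsum_tens //; lin.
Qed.

Lemma bicoact1 (P : lmodType k) (T : H -> A -> H -> P) : is_trilinear T ->
  bicoact (hone hA) T = T (hone hH) (hone hA) (hone hH).
Proof.
move=> hT; rewrite bicoactE // ba_rho_l1 tsum_tens; last first.
  by case: hT => h1 h2 h3; lin.
rewrite ba_rho_r1 tsum_tens.
  by rewrite !(ha_xi1 (ha_ax hH)) !(ha_xi1 (ha_ax hA)).
case: hT => h1 h2 h3.
by lin.
Qed.

Lemma bicoact_counit (P : lmodType k) (f : A -> P) a : linear f ->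
  bicoact a (fun u c v => ((eps u : k) * eps v) *: f c) = f a.
Proof.
move=> hf; rewrite -[RHS](lcounit a hf); apply: eq_tsum => u b.
rewrite -(rcounit b hf) -tsumZ; apply: eq_tsum => c v.
by rewrite scalerA.
Qed.

(** Coacting again on the middle leg splits both outer legs.  On the left the
    outer leg becomes the first factor of the coproduct, on the right the
    second one, hence the crossed order of v and v'. *)
Lemma bicoact_coassoc (P : lmodType k) (T : H -> H -> A -> H -> H -> P) a :
  (forall u2 c v1 v2, linear (fun u1 => T u1 u2 c v1 v2)) ->
  (forall u1 c v1 v2, linear (fun u2 => T u1 u2 c v1 v2)) ->
  (forall u1 u2 v1 v2, linear (fun c => T u1 u2 c v1 v2)) ->
  (forall u1 u2 c v2, linear (fun v1 => T u1 u2 c v1 v2)) ->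
  (forall u1 u2 c v1, linear (fun v2 => T u1 u2 c v1 v2)) ->
  bicoact a (fun u c v => bicoact c (fun u' d v' => T u u' d v' v)) =
  bicoact a (fun u c v => \tsum_(u1 ⊗ u2 <- D u) \tsum_(v1 ⊗ v2 <- D v)
     T u1 u2 c v1 v2).
Proof.
move=> h1 h2 h3 h4 h5.
transitivity (\tsum_(u ⊗ b <- L a) \tsum_(u' ⊗ c <- L b) \tsum_(d ⊗ v <- R c)
    \tsum_(e ⊗ v' <- R d) T u u' e v' v).
  apply: eq_tsum => u b.
  rewrite -(@bicoassoc _ (fun u' d v => \tsum_(e ⊗ v' <- R d) T u u' e v' v)) //.
  by split; lin.
rewrite -(@lcoassoc _ (fun u u' c => \tsum_(d ⊗ v <- R c)
    \tsum_(e ⊗ v' <- R d) T u u' e v' v)); last by split; lin.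
apply: eq_tsum => u b; rewrite [RHS]exchange_tsum.
apply: eq_tsum => u1 u2.
by rewrite (@rcoassoc _ (fun e v' v => T u1 u2 e v' v)) //; split; lin.
Qed.

(** For p one of S^-1(y) x and y S^-1(x), the four legs in H produced by coacting
    twice cancel in pairs. *)
Section Cancellation.
Variables (p : H -> H -> H) (hp : is_bilinear p).
Hypothesis p_comul : forall h,
  \tsum_(x ⊗ y <- D h) p x y = (eps h : k) *: hone hH.
Variables (P : lmodType k) (Q : H -> A -> H -> P) (hQ : is_trilinear Q).

Lemma bicoact_cancel a :
  bicoact a (fun u c v => bicoact c (fun u' d v' => Q (p u u') d (p v' v))) =
  Q (hone hH) a (hone hH).
Proof.
case: hQ hp => h1 h2 h3 [hp1 hp2].
rewrite (@bicoact_coassoc _ (fun u u' d v' v => Q (p u u') d (p v' v)));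
  try by lin.
rewrite -[RHS](@bicoact_counit _ (fun a => Q (hone hH) a (hone hH)));
  last by lin.
apply: eq_bicoact => u c v.
transitivity (\tsum_(u1 ⊗ u2 <- D u) ((eps v : k) *: Q (p u1 u2) c (hone hH))).
  apply: eq_tsum => u1 u2; pose l := linear_of (h3 (p u1 u2) c).
  rewrite -[RHS](linearZ_LR l) -p_comul linear_tsum.
  by apply: eq_tsum => v1 v2.
pose l := linear_of (h1 c (hone hH)).
rewrite tsumZ mulrC -scalerA; congr (_ *: _).
rewrite -[RHS](linearZ_LR l) -p_comul linear_tsum.
by apply: eq_tsum => u1 u2.
Qed.

End Cancellation.
End Bicoaction.

Local Opaque lreg rreg.

(** * Modules, comodules and the exchange rules *)

Section LeftModules.
Variables (k : fieldType) (A : lmodType k) (xiA : hom_aut A) (m : hom_mul A).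
Variables (M : lmodType k) (xiM : hom_aut M) (act : {bilinear A -> M -> M}).

Record is_untw_module (al : A -> M -> M) : Prop := IsUntwModule {
  um_mul : forall a b x, al (aut_inv xiA (hmul m a b)) x = al a (al b x);
  um_one : forall x, al (hone m) x = x;
  um_xi : forall a x, xiM (al a x) = al (xiA a) (xiM x) }.

(** Both sides of associativity acquire the same factor ξ^2. *)
Lemma untw_moduleP (al : A -> M -> M) :
  (forall a x, act a x = xiM (al a x)) ->
  is_left_module xiA m xiM act <-> is_untw_module al.
Proof.
move=> actE; split=> [[hA hx h1]|[hA h1 hx]].
  have alx a x : xiM (al a x) = al (xiA a) (xiM x).
    by apply: (can_inj (aut_invK xiM)); rewrite -!actE hx.
  split=> // [a b x|x]; apply: (can_inj (aut_invK xiM)); last by rewrite -actE.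
  apply: (can_inj (aut_invK xiM)).
  by have := hA a b x; rewrite !actE -!alx => ->; rewrite alx aut_invKV.
split=> [a b x|a x|x]; rewrite !actE ?h1 ?hx //.
by rewrite -!hx -hA !hx aut_invKV.
Qed.

End LeftModules.

Section Comodules.
Variables (k : fieldType) (H : vectType k) (xiH : hom_aut H).
Variables (hH : hom_hopf xiH) (M : lmodType k) (xiM : hom_aut M).
Local Notation Hd := 'Hom(H, k^o).
Local Notation e := (vbasis (fullv : {vspace H})).

Section Pairing.
Variable rho : {linear M -> tensor M H}.
Local Notation R := (untw_coop xiM xiH rho).

Lemma pairing_bilinear : is_bilinear (fun (f : Hd) x =>
  \tsum_(x0 ⊗ x1 <- R x) ((f x1 : k) *: x0)).
Proof. lin. Qed.

(** The action of the dual attached to a coaction: f · x = f(x_1) x_0. *)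
Definition pairing : {bilinear Hd -> M -> M} := bilinear_of pairing_bilinear.

Lemma pairingE (f : Hd) x :
  pairing f x = \tsum_(x0 ⊗ x1 <- R x) ((f x1 : k) *: x0).
Proof. by []. Qed.

Lemma slice_pairing (f : Hd) x :
  \tsum_(x0 ⊗ x1 <- rho x) ((f x1 : k) *: x0) =
  aut_inv xiM (pairing (xi_dual xiH f) x).
Proof.
rewrite pairingE tsum_untw; last by lin.
rewrite linear_tsum; apply: eq_tsum => x0 x1.
by rewrite linearZ_LR aut_invK; congr (_ *: _); apply/esym/xi_dual_xi.
Qed.

End Pairing.
Local Opaque pairing.

Section Coaction.
Variable phi : {bilinear Hd -> M -> M}.

Lemma coaction_of_linear : linear (fun x =>
  \sum_i (aut_inv xiM (phi (dual_basis i) x) ⊗ aut_inv xiH e`_i) : tensor M H).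
Proof.
have hl i : linear (fun x =>
    aut_inv xiM (phi (dual_basis i) x) ⊗ aut_inv xiH e`_i : tensor M H) by lin.
move=> c x y; rewrite scaler_sumr -big_split.
by apply: eq_bigr => i _; rewrite hl.
Qed.

(** The inverse of [pairing]: x goes to the sum of e^i · x ⊗ e_i over dual bases,
    twisted back. *)
Definition coaction_of : {linear M -> tensor M H} := linear_of coaction_of_linear.

Lemma pairing_coaction_of (f : Hd) x : pairing coaction_of f x = phi f x.
Proof.
have hl : linear (fun t : tensor M H =>
  \tsum_(m ⊗ h <- t) ((f h : k) *: m)) by lin.
pose t i := aut_inv xiM (phi (dual_basis i) x) ⊗ aut_inv xiH e`_i : tensor M H.
have tE : tens_map xiM xiH (\sum_i t i) = \sum_i tens_map xiM xiH (t i).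
  by rewrite linear_sum.
rewrite -[LHS]/(linear_of hl (tens_map xiM xiH (\sum_i t i))) tE linear_sum.
transitivity (phi (\sum_(i < \dim (fullv : {vspace H}))
    (f e`_i : k) *: dual_basis i) x).
  rewrite linear_sumlz; apply: eq_bigr => i _.
  rewrite /t tens_mapE !aut_invKV linear_ofE tsum_tens; last by lin.
  by rewrite linearZl_LR.
by rewrite -dual_expand.
Qed.

End Coaction.

Lemma coaction_ofK rho : coaction_of (pairing rho) = rho.
Proof.
apply: linear_ext => x; apply: slice_inj => f.
by rewrite !slice_pairing pairing_coaction_of.
Qed.

Record is_conv_module (phi : Hd -> M -> M) : Prop := IsConvModule {
  cm_mul : forall f g x, phi (conv hH f g) x = phi f (phi g x);
  cm_one : forall x, phi (dual_one hH) x = x;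
  cm_xi : forall f x, xiM (phi f x) = phi (xi_dual xiH f) (xiM x) }.

(** Coassociativity says that convolution acts by composition and the counit
    axiom that ε acts as the identity; conversely functionals on H detect the
    comodule axioms. *)
Lemma comoduleP rho :
  is_right_comodule hH xiM rho <-> is_conv_module (pairing rho).
Proof.
split=> [[hA hx h1]|[hA h1 hx]].
  split=> [f g x|x|f x].
  - rewrite !pairingE.
    transitivity (\tsum_(x0 ⊗ x1 <- untw_coop xiM xiH rho x)
        \tsum_(y ⊗ z <- ucomul hH x1) (((f y : k) * g z) *: x0)).
      by apply: eq_tsum => x0 x1; rewrite convE tsum_scale.
    rewrite -(@untw_coassoc _ _ _ _ _ _ _ _ xiM xiM xiH xiH xiH rho rho rho
      _ _ _ _ _ (fun x0 y z => ((f y : k) * g z) *: x0)) //.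
    - have hl : linear (fun x0 => pairing rho f x0) by lin.
      rewrite -pairingE -[RHS]/(linear_of hl _) linear_tsum.
      apply: eq_tsum => x0 x1; rewrite linearZ_LR linear_ofE pairingE -tsumZ.
      by apply: eq_tsum => y z; rewrite scalerA mulrC.
    - exact: hc_Delta_xi.
    - by split; lin.
  - rewrite pairingE tsum_untw; last by lin.
    apply: (can_inj (aut_invKV xiM)); rewrite -[RHS]h1 linear_tsum.
    apply: eq_tsum => x0 x1.
    by rewrite linearZ_LR aut_invK dual_oneE hc_eps_xi.
  - rewrite !pairingE !tsum_untw; [|lin..].
    rewrite hx tsum_tsum; last by lin.
    rewrite linear_tsum; apply: eq_tsum => x0 x1.
    rewrite tsum_tens; last by lin.
    by rewrite linearZ_LR; congr (_ *: _); apply/esym/xi_dual_xi.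
have hxi f x : aut_inv xiM (pairing rho f x) =
    pairing rho (xi_star xiH f) (aut_inv xiM x).
  apply: (can_inj (aut_invK xiM)).
  by rewrite hx !aut_invKV aut_invK.
have hinv f x : aut_inv xiM (pairing rho (xi_dual xiH f) x) =
    pairing rho f (aut_inv xiM x).
  by rewrite hxi aut_invKV.
have hinv2 f x : aut_inv xiM (aut_inv xiM
    (pairing rho (xi_dual xiH (xi_dual xiH f)) x)) =
    pairing rho f (aut_inv xiM (aut_inv xiM x)).
  exact: etrans (congr1 (aut_inv xiM) (hinv (xi_dual xiH f) x)) (hinv f _).
split=> [x|x|x].
- apply: slice2_inj => f g.
  transitivity (aut_inv xiM (aut_inv xiM
    (pairing rho (xi_dual xiH (xi_dual xiH (conv hH f g))) x))).
    rewrite -dual_mul_conv -slice_pairing linear_tsum.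
    rewrite tsum_tsum; last by lin.
    apply: eq_tsum => x0 x1; rewrite tsum_tens; last by lin.
    rewrite linearZ_LR -[dual_mul _ _ _]/(dual_mul_fun _ _ _) dual_mulE.
    by rewrite tsum_scale.
  rewrite tsum_tsum; last by lin.
  transitivity (\tsum_(x0 ⊗ x1 <- rho x) ((g (aut_inv xiH x1) : k) *:
      aut_inv xiM (pairing rho (xi_dual xiH f) x0))).
    have hl : linear (fun y => aut_inv xiM (pairing rho (xi_dual xiH f) y))
      by lin.
    transitivity (linear_of hl (\tsum_(x0 ⊗ x1 <- rho x)
        ((xi_dual xiH g x1 : k) *: x0))).
      rewrite linear_ofE slice_pairing.
      apply: (etrans (hinv2 (conv hH f g) x)); apply: (etrans (hA f g _)).
      apply/esym/(etrans (hinv f _)).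
      exact: (congr1 (pairing rho f) (hinv2 g x)).
    rewrite linear_tsum; apply: eq_tsum => x0 x1.
    by rewrite linearZ_LR linear_ofE; congr (_ *: _); apply: xi_dualE.
  apply: eq_tsum => x0 x1; rewrite tsum_tsum; last by lin.
  rewrite -slice_pairing -tsumZ; apply: eq_tsum => y0 y1.
  rewrite tsum_tens; last by lin.
  by rewrite tsum_tens ?scalerA 1?mulrC //; lin.
- apply: slice_inj => f.
  rewrite slice_pairing hinv aut_invK tsum_tsum; last by lin.
  rewrite pairingE tsum_untw; last by lin.
  by apply: eq_tsum => x0 x1; rewrite tsum_tens //; lin.
- transitivity (aut_inv xiM (pairing rho (xi_dual xiH (dual_one hH)) x)).
    by rewrite -slice_pairing; apply: eq_tsum => x0 x1; rewrite dual_oneE.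
  by rewrite hinv h1.
Qed.

End Comodules.

Section Crossing.
Variables (k : fieldType) (H : vectType k) (xiH : hom_aut H).
Variables (hH : hom_hopf xiH) (bS : bijective (antipode hH)).
Variables (A : lmodType k) (xiA : hom_aut A) (hA : hom_bicomod_algebra hH xiA).
Variables (M : lmodType k) (xiM : hom_aut M).
Local Notation Hd := 'Hom(H, k^o).
Local Notation S' := (linv bS).
Local Notation tr u v f := (translate hH u v f).
Variables (phi : {bilinear Hd -> M -> M}) (al : {bilinear A -> M -> M}).

(** The exchange rule coming from the product (ε ⋈ a)(f ⋈ 1). *)
Definition cross_left := forall a f x,
  al a (phi f x) = bicoact hA a (fun u c v => phi (tr u (S' v) f) (al c x)).

(** The exchange rule expressing Yetter-Drinfeld compatibility. *)
Definition cross_right := forall a f x,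
  phi f (al a x) = bicoact hA a (fun u c v => al c (phi (tr (S' u) v f) x)).

(** Each rule follows from the other by expanding one factor of its right-hand
    side: the translations compose, and their legs cancel by
    [bicoact_cancel]. *)
Lemma cross_leftP : cross_left <-> cross_right.
Proof.
split=> cr a f x.
  have hQ : is_trilinear (fun u c v => phi (tr u v f) (al c x)) by split; lin.
  have hp : is_bilinear (fun x y => umul hH y (S' x)) by lin.
  transitivity (phi (tr (hone hH) (hone hH) f) (al a x)).
    by rewrite translate1.
  apply: (etrans (esym (bicoact_cancel hA hp (antipode_invr bS) hQ a))).
  apply: eq_bicoact => u c v; rewrite cr; apply: eq_bicoact => u' d v'.
  by rewrite translateM.
have hQ : is_trilinear (fun u c v => al c (phi (tr u v f) x)) by split; lin.
have hp : is_bilinear (fun x y => umul hH (S' y) x) by lin.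
transitivity (al a (phi (tr (hone hH) (hone hH) f) x)).
  by rewrite translate1.
apply: (etrans (esym (bicoact_cancel hA hp (antipode_invl bS) hQ a))).
apply: eq_bicoact => u c v; rewrite cr; apply: eq_bicoact => u' d v'.
by rewrite translateM.
Qed.

End Crossing.

Section YetterDrinfeldCompatibility.
Variables (k : fieldType) (H : vectType k) (xiH : hom_aut H).
Variables (hH : hom_hopf xiH) (bS : bijective (antipode hH)).
Variables (A : lmodType k) (xiA : hom_aut A) (hA : hom_bicomod_algebra hH xiA).
Variables (M : lmodType k) (xiM : hom_aut M).
Local Notation Hd := 'Hom(H, k^o).
Local Notation S' := (linv bS).
Variables (rho : {linear M -> tensor M H}) (act : {bilinear A -> M -> M}).
Variable al : {bilinear A -> M -> M}.
Hypothesis actE : forall a x, act a x = xiM (al a x).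
Hypothesis al_xi : forall a x, xiM (al a x) = al (xiA a) (xiM x).
Hypothesis pairing_xi : forall (f : Hd) x,
  xiM (pairing xiH xiM rho f x) = pairing xiH xiM rho (xi_dual xiH f) (xiM x).

(** Slicing the compatibility condition along f gives the exchange rule at f, and
    functionals separate. *)
Lemma yd_compatP :
  (forall a x, rho (act a x) =
    \tsum_(a1 ⊗ a0 <- rho_l hA a) \tsum_(a00 ⊗ a01 <- rho_r hA a0)
    \tsum_(x0 ⊗ x1 <- rho x)
      (act (xiA a00) x0
       ⊗ hmul hH (hmul hH a01 (aut_inv xiH x1)) (S' a1))) <->
  cross_right bS hA (pairing xiH xiM rho) al.
Proof.
pose F (f : Hd) a x := \tsum_(a1 ⊗ a0 <- rho_l hA a)
    \tsum_(a00 ⊗ a01 <- rho_r hA a0) \tsum_(x0 ⊗ x1 <- rho x)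
      ((f (hmul hH (hmul hH a01 (aut_inv xiH x1)) (S' a1)) : k) *:
        act (xiA a00) x0).
have sliceL (f : Hd) a x :
    \tsum_(m ⊗ h <- rho (act a x)) ((f h : k) *: m) =
    pairing xiH xiM rho f (al a x).
  rewrite (slice_pairing xiH xiM) actE; apply: (can_inj (aut_invK xiM)).
  by rewrite aut_invKV pairing_xi.
have sliceR (f : Hd) a x :
    bicoact hA a (fun u c v =>
      al c (pairing xiH xiM rho (translate hH (S' u) v f) x)) = F f a x.
  rewrite bicoactE; last by split; lin.
  apply: eq_tsum => a1 a0; apply: eq_tsum => a00 a01.
  rewrite pairingE tsum_untw; last by lin.
  rewrite linear_tsum; apply: eq_tsum => x0 x1.
  rewrite linearZ_LR /= translateE actE al_xi; congr ((f _ : k) *: _).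
  by rewrite !hmulE !umul_xi aut_invKV antipode_inv_xi.
split=> h a; last first.
  move=> x; apply: slice_inj => f; rewrite sliceL h sliceR.
  rewrite tsum_tsum; last by lin.
  apply: eq_tsum => a1 a0; rewrite tsum_tsum; last by lin.
  apply: eq_tsum => a00 a01; rewrite tsum_tsum; last by lin.
  by apply: eq_tsum => x0 x1; rewrite tsum_tens //; lin.
move=> f x; rewrite sliceR -sliceL h.
rewrite tsum_tsum; last by lin.
apply: eq_tsum => a1 a0; rewrite tsum_tsum; last by lin.
apply: eq_tsum => a00 a01; rewrite tsum_tsum; last by lin.
by apply: eq_tsum => x0 x1; rewrite tsum_tens //; lin.
Qed.

End YetterDrinfeldCompatibility.

Local Opaque conv umul.

(** * Modules over the diagonal crossed product *)

Section DiagonalModules.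
Variables (k : fieldType) (H : vectType k) (xiH : hom_aut H).
Variables (hH : hom_hopf xiH) (bS : bijective (antipode hH)).
Variables (A : lmodType k) (xiA : hom_aut A) (hA : hom_bicomod_algebra hH xiA).
Local Notation Hd := 'Hom(H, k^o).
Local Notation S' := (linv bS).
Local Notation tr u v f := (translate hH u v f).
Local Notation eps := (dual_one hH).
Local Notation "𝟙" := (hone hA).
Local Notation D := (diag_crossed bS hA).
Local Notation xiD := (diag_xi xiH xiA).

Lemma diag_xiE (f : Hd) a : xiD (f ⊗ a) = xi_dual xiH f ⊗ xiA a.
Proof. exact: tens_mapE. Qed.

(** The product (f ⋈ a)(g ⋈ b) without its twist, by [udiagE]. *)
Definition udiag (f : Hd) (a : A) (g : Hd) (b : A) : tensor Hd A :=
  bicoact hA a (fun u c v => conv hH f (tr u (S' v) g) ⊗ umul hA c b).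

Lemma udiagE f a g b : aut_inv xiD (hmul D (f ⊗ a) (g ⊗ b)) = udiag f a g b.
Proof.
rewrite diag_crossedE -[RHS](aut_invK xiD); congr (aut_inv xiD _).
rewrite [RHS]linear_bicoact; last by lin.
rewrite bicoactE; last by split; lin.
apply: eq_tsum => a1 a0; apply: eq_tsum => a00 a01.
rewrite diag_xiE -hmulE -dual_mul_conv; congr (_ ⊗ _).
by rewrite hit_translate !antipode_inv_xi.
Qed.

Lemma udiag1 f g b : udiag f 𝟙 g b = conv hH f g ⊗ b.
Proof.
rewrite /udiag bicoact1; last by split; lin.
by rewrite antipode_inv1 translate1 u1mul.
Qed.

Lemma udiag_eps a b : udiag eps a eps b = eps ⊗ umul hA a b.
Proof.
rewrite -[RHS](bicoact_counit hA a (f := fun c => eps ⊗ umul hA c b));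
  last by lin.
apply: eq_bicoact => u c v.
by rewrite translate_one heps_antipode_inv linearZr_LR tensZl conv1f.
Qed.

Lemma udiag_cross a g :
  udiag eps a g 𝟙 = bicoact hA a (fun u c v => tr u (S' v) g ⊗ c).
Proof. by apply: eq_bicoact => u c v; rewrite conv1f umul1. Qed.

Variables (M : lmodType k) (xiM : hom_aut M).

(** What a Yetter-Drinfeld module and a module over the diagonal crossed product
    have in common. *)
Record is_crossed_pair (phi : {bilinear Hd -> M -> M})
    (al : {bilinear A -> M -> M}) : Prop := IsCrossedPair {
  cp_al : is_untw_module xiA hA xiM al;
  cp_phi : is_conv_module hH xiM phi;
  cp_cross : cross_left bS hA phi al }.

Section FromPair.
Variables (phi : {bilinear Hd -> M -> M}) (al : {bilinear A -> M -> M}).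

Lemma diag_act_bilinear :
  is_bilinear (fun t x => \tsum_(f ⊗ a <- t) phi f (al a x)).
Proof. lin. Qed.

Definition diag_act : {bilinear tensor Hd A -> M -> M} :=
  bilinear_of diag_act_bilinear.

Lemma diag_actE f a x : diag_act (f ⊗ a) x = phi f (al a x).
Proof. by apply: tsum_tens; lin. Qed.

Hypothesis cp : is_crossed_pair phi al.

Lemma al_umul a b x : al (umul hA a b) x = al a (al b x).
Proof.
by rewrite -(um_mul (cp_al cp)) hmulE aut_invK.
Qed.

(** On pure tensors associativity asks that
    phi f (phi (a_-1 ⇀ g ↼ S^-1(a_01)) (al a_00 (al b x))) be
    phi f (al a (phi g (al b x))), which is the exchange rule. *)
Lemma diag_act_module : is_untw_module xiD D xiM diag_act.
Proof.
case: (cp) => [[_ al1 alx] [phiM phi1 phix] cr].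
split=> [s t x|x|t x].
- pose lhs s' t' := diag_act (aut_inv xiD (hmul D s' t')) x.
  pose rhs s' t' := diag_act s' (diag_act t' x).
  rewrite -[LHS]/(lhs s t) -[RHS]/(rhs s t).
  apply: (linear_tens_ext (F := lhs^~ t) (G := rhs^~ t)); rewrite /lhs /rhs.
  + by lin.
  + by lin.
  move=> f a; apply: (linear_tens_ext (F := lhs (f ⊗ a)) (G := rhs (f ⊗ a)));
    rewrite /lhs /rhs.
  + by lin.
  + by lin.
  move=> g b; rewrite udiagE !diag_actE cr.
  rewrite [LHS](linear_bicoact hA (f := fun w => diag_act w x)); last by lin.
  rewrite [RHS](linear_bicoact hA (f := fun w => phi f w)); last by lin.
  by apply: eq_bicoact => u c v; rewrite diag_actE phiM al_umul.
- by rewrite -[hone D]/(eps ⊗ 𝟙) diag_actE al1 phi1.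
apply: (linear_tens_ext (F := fun t' => xiM (diag_act t' x))
  (G := fun t' => diag_act (xiD t') (xiM x))).
+ by lin.
+ by lin.
by move=> f a; rewrite diag_xiE !diag_actE phix alx.
Qed.

End FromPair.

Section ToPair.
Variable act : {bilinear tensor Hd A -> M -> M}.

Lemma dual_part_bilinear : is_bilinear (fun f x => act (f ⊗ 𝟙) x).
Proof. lin. Qed.

Lemma alg_part_bilinear : is_bilinear (fun a x => act (eps ⊗ a) x).
Proof. lin. Qed.

Definition dual_part : {bilinear Hd -> M -> M} := bilinear_of dual_part_bilinear.
Definition alg_part : {bilinear A -> M -> M} := bilinear_of alg_part_bilinear.

Lemma dual_partE f x : dual_part f x = act (f ⊗ 𝟙) x. Proof. by []. Qed.
Lemma alg_partE a x : alg_part a x = act (eps ⊗ a) x. Proof. by []. Qed.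

Hypothesis hact : is_untw_module xiD D xiM act.

Lemma udiag_act f a g b x : act (udiag f a g b) x = act (f ⊗ a) (act (g ⊗ b) x).
Proof. by rewrite -(um_mul hact) udiagE. Qed.

Lemma diag_act_parts f a x : act (f ⊗ a) x = dual_part f (alg_part a x).
Proof. by rewrite dual_partE alg_partE -udiag_act udiag1 convf1. Qed.

(** The restrictions along f ↦ f ⋈ 1 and a ↦ ε ⋈ a are algebra maps, and the
    exchange rule is the module law for (ε ⋈ a)(g ⋈ 1). *)
Lemma parts_crossed_pair : is_crossed_pair dual_part alg_part.
Proof.
have aut1 : xiA 𝟙 = 𝟙 by exact: ha_xi1 (ha_ax hA).
split; first split=> [a b x|x|a x].
- by rewrite !alg_partE hmulE aut_invK -udiag_act udiag_eps.
- exact: um_one hact x.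
- by rewrite !alg_partE (um_xi hact) diag_xiE dual_one_xi.
- split=> [f g x|x|f x].
  + by rewrite !dual_partE -udiag_act udiag1.
  + exact: um_one hact x.
  + by rewrite !dual_partE (um_xi hact) diag_xiE aut1.
move=> a g x; rewrite {1}alg_partE {1}dual_partE -udiag_act udiag_cross.
rewrite [LHS](linear_bicoact hA (f := fun w => act w x)); last by lin.
by apply: eq_bicoact => u c v; rewrite diag_act_parts.
Qed.

End ToPair.
End DiagonalModules.

(** * Equality of functors *)

Section FunctorEquality.
Variables (C D : category).

(** Two functors that agree on objects send a morphism into types that are equal
    but not convertible; bundling source and target makes the images
    comparable without casts. *)
Definition mor_in (X Y : C) (f : mor X Y) : {p : C * C & mor p.1 p.2} :=
  existT (fun p : C * C => mor p.1 p.2) (X, Y) f.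

End FunctorEquality.

(** The equality of source and target contained in the hypothesis is a proof of
    (X, Y) = (X, Y), so by proof irrelevance transport along it is trivial. *)
Lemma mor_in_inj (C : category) (X Y : C) : injective (@mor_in C X Y).
Proof.
move=> f g e; rewrite -[g](projT2_eq e).
by rewrite (Prop_irrelevance (projT1_eq e) erefl).
Qed.

Lemma functor_eq (C D : category) (F G : functor C D) :
  (forall X Y (f : mor X Y), mor_in (fmor F f) = mor_in (fmor G f)) -> F = G.
Proof.
case: F => F0 F1 F2 F3; case: G => G0 G1 G2 G3 /= h.
have e : F0 = G0.
  apply: funext => X.
  exact: (congr1 (fun z => (projT1 z).1) (h X X (mor_id X))).
subst G0; have e : F1 = G1.
  apply: functional_extensionality_dep => X.
  apply: functional_extensionality_dep => Y.
  by apply: funext => f; apply: mor_in_inj.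
by subst G1; congr Functor; apply: Prop_irrelevance.
Qed.

(** * The inverse isomorphisms *)

Section Isomorphism.
Variables (k : fieldType) (H : vectType k) (xiH : hom_aut H).
Variables (hH : hom_hopf xiH) (bS : bijective (antipode hH)).
Variables (A : lmodType k) (xiA : hom_aut A) (hA : hom_bicomod_algebra hH xiA).
Local Notation Hd := 'Hom(H, k^o).
Local Notation D := (diag_crossed bS hA).
Local Notation xiD := (diag_xi xiH xiA).
Local Notation YD := (yd_module bS hA).
Local Notation Mod := (left_module xiD D).

Lemma twist_op_bilinear (U V W : lmodType k) (xi : hom_aut W)
    (b : {bilinear U -> V -> W}) : is_bilinear (fun x y => xi (b x y)).
Proof. lin. Qed.

Definition twist_op (U V W : lmodType k) (xi : hom_aut W)
    (b : {bilinear U -> V -> W}) : {bilinear U -> V -> W} :=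
  bilinear_of (twist_op_bilinear xi b).

Lemma twist_opE (U V W : lmodType k) (xi : hom_aut W)
    (b : {bilinear U -> V -> W}) x y : twist_op xi b x y = xi (b x y).
Proof. by []. Qed.

Lemma twist_opK (U V W : lmodType k) (xi : hom_aut W)
    (b : {bilinear U -> V -> W}) : untw_op xi (twist_op xi b) = b.
Proof.
apply: bilinear_ext => x y; apply: (can_inj (aut_invK xi)).
by rewrite -untw_opE.
Qed.

(** Colinear maps are the maps commuting with the action of the dual. *)
Lemma pairing_morphism (M N : lmodType k) (xiM : hom_aut M) (xiN : hom_aut N)
    (rhoM : {linear M -> tensor M H}) (rhoN : {linear N -> tensor N H})
    (f : {linear M -> N}) : (forall x, f (xiM x) = xiN (f x)) ->
  (forall x, rhoN (f x) = \tsum_(x0 ⊗ x1 <- rhoM x) (f x0 ⊗ x1)) <->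
  (forall (g : Hd) x,
     f (pairing xiH xiM rhoM g x) = pairing xiH xiN rhoN g (f x)).
Proof.
move=> fxi.
have fxiV x : f (aut_inv xiM x) = aut_inv xiN (f x).
  by apply: (can_inj (aut_invK xiN)); rewrite -fxi !aut_invKV.
split=> h => [g|] x.
  rewrite !pairingE !tsum_untw; [|lin..].
  rewrite h tsum_tsum; last by lin.
  rewrite linear_tsum; apply: eq_tsum => x0 x1.
  rewrite tsum_tens; last by lin.
  by rewrite linearZ_LR fxi.
apply: slice_inj => g; rewrite (slice_pairing xiH xiN) -h -fxiV -slice_pairing.
rewrite linear_tsum tsum_tsum; last by lin.
apply: eq_tsum => x0 x1; rewrite tsum_tens; last by lin.
by rewrite linearZ_LR.
Qed.

Section ToModule.
Variable M : YD.
Local Notation xiM := (yd_xiM M).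

Definition yd_phi := pairing xiH xiM (yd_rho M).
Definition yd_al := untw_op xiM (yd_act M).

Lemma yd_crossed_pair : is_crossed_pair bS hA xiM yd_phi yd_al.
Proof.
have hal : is_untw_module xiA hA xiM yd_al.
  exact: (untw_moduleP _ _ (untw_opE xiM _)).1 (yd_left M).
have hphi : is_conv_module hH xiM yd_phi := (comoduleP _ _ _).1 (yd_right M).
split=> //; apply/cross_leftP.
apply: (yd_compatP bS hA (untw_opE xiM _) (um_xi hal) (cm_xi hphi)).1.
exact: yd_compat.
Qed.

Definition mod_act := twist_op xiM (diag_act yd_phi yd_al).

Lemma mod_act_module : is_left_module xiD D xiM mod_act.
Proof.
exact: (untw_moduleP _ _ (twist_opE xiM _)).2 (diag_act_module yd_crossed_pair).
Qed.

Definition mod_of_yd : Mod := LeftModule mod_act_module.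

End ToModule.

Section ToYD.
Variable N : Mod.
Local Notation xiN := (lm_xiM N).

Definition untw_act := untw_op xiN (lm_act N).

Lemma mod_crossed_pair :
  is_crossed_pair bS hA xiN (dual_part hA untw_act) (alg_part hH untw_act).
Proof.
apply: parts_crossed_pair.
exact: (untw_moduleP _ _ (untw_opE xiN _)).1 (lm_ax N).
Qed.

Definition alg_act := twist_op xiN (alg_part hH untw_act).
Definition dual_coact := coaction_of xiH xiN (dual_part hA untw_act).

Lemma pairing_dual_coact : pairing xiH xiN dual_coact = dual_part hA untw_act.
Proof. by apply: bilinear_ext => f x; rewrite pairing_coaction_of. Qed.

Lemma yd_of_mod_left : is_left_module xiA hA xiN alg_act.
Proof.
exact: (untw_moduleP _ _ (twist_opE xiN _)).2 (cp_al mod_crossed_pair).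
Qed.

Lemma yd_of_mod_right : is_right_comodule hH xiN dual_coact.
Proof.
apply: (comoduleP _ _ _).2; rewrite pairing_dual_coact.
exact: cp_phi mod_crossed_pair.
Qed.

Lemma yd_of_mod_compat a x :
  dual_coact (alg_act a x) =
    \tsum_(a1 ⊗ a0 <- rho_l hA a) \tsum_(a00 ⊗ a01 <- rho_r hA a0)
    \tsum_(x0 ⊗ x1 <- dual_coact x)
      (alg_act (xiA a00) x0
       ⊗ hmul hH (hmul hH a01 (aut_inv xiH x1)) (linv bS a1)).
Proof.
have [hal hphi hcr] := mod_crossed_pair.
apply: (yd_compatP bS hA (twist_opE xiN _) (um_xi hal) _).2;
  rewrite pairing_dual_coact; first exact: cm_xi hphi.
exact/cross_leftP.
Qed.

Definition yd_of_mod : YD :=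
  YDModule yd_of_mod_left yd_of_mod_right yd_of_mod_compat.

End ToYD.

Section ToModuleMor.
Variables (M N : YD) (f : yd_mor M N).

Lemma yd_mor_phi g x : f (yd_phi M g x) = yd_phi N g (f x).
Proof. exact: (pairing_morphism _ _ (ydm_xi f)).1 (ydm_rho f) g x. Qed.

Lemma yd_mor_al a x : f (yd_al M a x) = yd_al N a (f x).
Proof.
apply: (can_inj (aut_invK (yd_xiM N))).
by rewrite -ydm_xi -!untw_opE ydm_act.
Qed.

Lemma yd_mor_mod_act t x : f (mod_act M t x) = mod_act N t (f x).
Proof.
rewrite !twist_opE ydm_xi; congr (yd_xiM N _).
rewrite -[LHS]/(f (tsum _ _)) linear_tsum; apply: eq_tsum => g a.
by rewrite yd_mor_phi yd_mor_al.
Qed.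

Definition mod_mor_of_yd : left_module_mor (mod_of_yd M) (mod_of_yd N) :=
  @LeftModuleMor _ _ _ _ (mod_of_yd M) (mod_of_yd N) f (ydm_xi f) yd_mor_mod_act.

End ToModuleMor.

Section ToYDMor.
Variables (M N : Mod) (f : left_module_mor M N).

Lemma mod_mor_untw_act t x : f (untw_act M t x) = untw_act N t (f x).
Proof.
apply: (can_inj (aut_invK (lm_xiM N))).
by rewrite -lmm_xi -!untw_opE lmm_act.
Qed.

Lemma mod_mor_alg_act a x : f (alg_act M a x) = alg_act N a (f x).
Proof. by rewrite !twist_opE lmm_xi !alg_partE mod_mor_untw_act. Qed.

Lemma mod_mor_dual_coact x :
  dual_coact N (f x) = \tsum_(x0 ⊗ x1 <- dual_coact M x) (f x0 ⊗ x1).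
Proof.
apply: (pairing_morphism _ _ (lmm_xi f)).2 => g y.
by rewrite !pairing_dual_coact !dual_partE mod_mor_untw_act.
Qed.

Definition yd_mor_of_mod : yd_mor (yd_of_mod M) (yd_of_mod N) :=
  @YDMor _ _ _ _ _ _ _ _ (yd_of_mod M) (yd_of_mod N) f (lmm_xi f)
    mod_mor_alg_act mod_mor_dual_coact.

End ToYDMor.

Definition mod_functor : functor (yd_category bS hA) (left_module_category xiD D).
Proof.
refine (@Functor (yd_category bS hA) (left_module_category xiD D)
  mod_of_yd mod_mor_of_yd _ _) => *; exact: left_module_mor_ext.
Defined.

Definition yd_functor : functor (left_module_category xiD D) (yd_category bS hA).
Proof.
refine (@Functor (left_module_category xiD D) (yd_category bS hA)
  yd_of_mod yd_mor_of_mod _ _) => *; exact: yd_mor_ext.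
Defined.

(** A Yetter-Drinfeld module rebuilt on the same space from equal structure maps
    is the same object, and morphisms are determined by their maps. *)
Lemma yd_mor_in_eq (M N : YD) actM rhoM lM rM cM actN rhoN lN rN cN
    (M' := @YDModule _ _ _ hH bS _ _ hA M (yd_xiM M) actM rhoM lM rM cM)
    (N' := @YDModule _ _ _ hH bS _ _ hA N (yd_xiM N) actN rhoN lN rN cN)
    (f' : yd_mor M' N') (f : yd_mor M N) :
  actM = yd_act M -> rhoM = yd_rho M -> actN = yd_act N -> rhoN = yd_rho N ->
  (forall x : M, f' x = f x) ->
  @mor_in (yd_category bS hA) M' N' f' = @mor_in (yd_category bS hA) M N f.
Proof.
subst M' N'; case: M actM rhoM lM rM cM f' f => M xiM aM rM lM' rM' cM' /=.
move=> actM rhoM lM rM0 cM.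
case: N actN rhoN lN rN cN => N xiN aN rN lN' rN' cN' /=.
move=> actN rhoN lN rN0 cN f' f eM1 eM2 eN1 eN2.
subst actM rhoM actN rhoN => ff.
have eq1 := Prop_irrelevance lM lM'; have eq2 := Prop_irrelevance rM0 rM'.
have eq3 := Prop_irrelevance cM cM'.
have eq4 := Prop_irrelevance lN lN'; have eq5 := Prop_irrelevance rN0 rN'.
have eq6 := Prop_irrelevance cN cN'.
subst lM rM0 cM lN rN0 cN.
by have -> : f' = f by exact: yd_mor_ext.
Qed.

Lemma module_mor_in_eq (M N : Mod) actM pM actN pN
    (M' := @LeftModule _ _ xiD D M (lm_xiM M) actM pM)
    (N' := @LeftModule _ _ xiD D N (lm_xiM N) actN pN)
    (f' : left_module_mor M' N') (f : left_module_mor M N) :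
  actM = lm_act M -> actN = lm_act N -> (forall x : M, f' x = f x) ->
  @mor_in (left_module_category xiD D) M' N' f' =
  @mor_in (left_module_category xiD D) M N f.
Proof.
subst M' N'; case: M actM pM f' f => M xiM aM pM' actM pM.
case: N actN pN => N xiN aN pN' actN pN /= f' f eM eN.
subst actM actN => ff.
have eq1 := Prop_irrelevance pM pM'; have eq2 := Prop_irrelevance pN pN'.
subst pM pN.
by have -> : f' = f by exact: left_module_mor_ext.
Qed.

Lemma yd_act_roundtrip (M : YD) : alg_act (mod_of_yd M) = yd_act M.
Proof.
apply: bilinear_ext => a x; rewrite twist_opE alg_partE /untw_act twist_opK.
rewrite diag_actE (cm_one (cp_phi (yd_crossed_pair M))).
by rewrite -untw_opE.
Qed.

Lemma yd_rho_roundtrip (M : YD) : dual_coact (mod_of_yd M) = yd_rho M.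
Proof.
rewrite /dual_coact -[RHS](coaction_ofK xiH (yd_xiM M)).
congr (coaction_of _ _ _); apply: bilinear_ext => f x.
rewrite dual_partE /untw_act twist_opK diag_actE.
by rewrite (um_one (cp_al (yd_crossed_pair M))).
Qed.

Lemma mod_act_roundtrip (N : Mod) : mod_act (yd_of_mod N) = lm_act N.
Proof.
apply: bilinear_ext => t x; rewrite twist_opE [RHS](untw_opE (lm_xiM N)).
congr (lm_xiM N _).
apply: (linear_tens_ext (F := fun t => diag_act _ _ t x)
  (G := fun t => untw_act N t x)); [by lin | by lin |] => f a.
rewrite diag_actE /yd_al twist_opK /yd_phi pairing_dual_coact.
apply/esym/(diag_act_parts (bS := bS) (xiM := lm_xiM N)).
exact: (untw_moduleP _ _ (untw_opE _ _)).1 (lm_ax N).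
Qed.

End Isomorphism.

Theorem theorem2p7 (k : fieldType)
    (H : vectType k) (xiH : hom_aut H) (hH : hom_hopf xiH)
    (bS : bijective (antipode hH))
    (A : lmodType k) (xiA : hom_aut A) (hA : hom_bicomod_algebra hH xiA) :
  isomorphic_categories
    (yd_category bS hA)
    (left_module_category (diag_xi xiH xiA) (diag_crossed bS hA)).
Proof.
exists (mod_functor bS hA), (yd_functor bS hA); split; apply: functor_eq => M N f.
  by apply: yd_mor_in_eq => //;
    first [exact: yd_act_roundtrip | exact: yd_rho_roundtrip].
by apply: module_mor_in_eq => //; exact: mod_act_roundtrip.
Qed.
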